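(* For every finite $m\geq 1$, the tree $\mathcal{A}_{m+1}=[m+1:\omega]$ satisfies $\operatorname{SSC}(\mathcal{A}_{m+1})=\Pi^{\mathrm{in}}_{2m+2}$.
   Context: Trees. A tree is a structure $(T,\prec)$ in the language $\{\prec\}$ where $\prec$ is a strict partial order, the predecessors of each element form a finite linearly ordered set, and there is a $\prec$-least element, the root; trees are countable and have no infinite paths. The level of $x$ is its number of predecessors. Rank: terminal nodes have rank $0$, $\mathrm{rk}(x)=\sup\{\mathrm{rk}(y)+1: y$ an immediate successor of $x\}$, and the rank of $T$ is that of its root. For finite $n\geq1$ and $N\in\omega\cup\{\omega\}$ the tree type $[n:N]$ is defined inductively: $[1:N]$ is the tree of rank $\leq1$ whose root has exactly $N$ children; $[n:N]$ ($n\geq 2$) is the tree of rank $n$ in which exactly $N$ level-one nodes are roots of subtrees of type $[n-1:\omega]$, for every $k\in\omega$ (including $k=0$) infinitely many level-one nodes are roots of subtrees of type $[n-1:k]$, and there are no other level-one nodes. (''$\omega$ many'' and ''infinitely many'' mean countably infinitely many.) Infinitary formulas: $\Sigma^{\mathrm{in}}_0=\Pi^{\mathrm{in}}_0$ are the finitary quantifier-free formulas; for $\alpha\geq1$, a $\Sigma^{\mathrm{in}}_\alpha$ formula is a countable disjunction of formulas $\exists\bar y\,\psi$ with $\psi\in\Pi^{\mathrm{in}}_\beta$, $\beta<\alpha$, and dually $\Pi^{\mathrm{in}}_\alpha$ (countable conjunctions of $\forall\bar y\,\psi$, $\psi\in\Sigma^{\mathrm{in}}_\beta$, $\beta<\alpha$).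 A $\mathrm{d}\text{-}\Sigma^{\mathrm{in}}_\alpha$ formula is a conjunction of a $\Sigma^{\mathrm{in}}_\alpha$ and a $\Pi^{\mathrm{in}}_\alpha$ formula. A Scott sentence of a countable structure is an $L_{\omega_1\omega}$ sentence whose countable models are exactly its isomorphic copies. $\operatorname{SSC}(\mathcal{A})$ (Scott sentence complexity) is the least complexity among $\Sigma^{\mathrm{in}}_\alpha,\Pi^{\mathrm{in}}_\alpha,\mathrm{d}\text{-}\Sigma^{\mathrm{in}}_\alpha$ of a Scott sentence of $\mathcal{A}$, in the ordering $\Sigma^{\mathrm{in}}_\alpha,\Pi^{\mathrm{in}}_\alpha<\mathrm{d}\text{-}\Sigma^{\mathrm{in}}_\alpha<\Sigma^{\mathrm{in}}_{\alpha+1},\Pi^{\mathrm{in}}_{\alpha+1}$ (a least one is known to exist). *)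

(* Defs.v *)
From mathcomp Require Import all_boot.
From mathcomp Require Import boolp classical_sets functions cardinality.

Set Implicit Arguments.
Unset Strict Implicit.
Unset Printing Implicit Defensive.

Local Open Scope classical_set_scope.
Local Open Scope card_scope.

(* Notations for the countable ordinals: [Osup f] denotes the supremum of the
   ordinals [f i], where [f] need not be increasing. Every countable ordinal
   has a notation. Notations are not unique, so ordinals are compared with
   [ole] and [olt], never with [=]. *)
Inductive ord : Type :=
| Ozero
| Osucc of ord
| Osup of (nat -> ord).

Inductive ole : ord -> ord -> Prop :=
| ole_zero b : ole Ozero b
| ole_succ a b : ole a b -> ole (Osucc a) (Osucc b)
| ole_sup a f i : ole a (f i) -> ole a (Osup f)
| sup_ole f b : (forall i, ole (f i) b) -> ole (Osup f) b.

Definition olt (a b : ord) : Prop := ole (Osucc a) b.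

Definition ofin (n : nat) : ord := iter n Osucc Ozero.

Record structure : Type := Structure {
  carrier :> Type;
  prec : carrier -> carrier -> Prop }.

Arguments prec {s} x y.

Definition isomorphic (A B : structure) : Prop :=
  exists f : A -> B, bijective f /\ forall x y, prec x y <-> prec (f x) (f y).

Section Trees.
Variable T : structure.
Implicit Types x y z r : T.

Definition is_root r : Prop := forall x, x = r \/ prec r x.

Record is_tree : Prop := IsTree {
  tree_irr : forall x, ~ prec x x;
  tree_trans : forall x y z, prec x y -> prec y z -> prec x z;
  tree_finite : forall x, finite_set [set y | prec y x];
  tree_linear : forall x y z, prec y x -> prec z x ->
    prec y z \/ y = z \/ prec z y;
  tree_root : exists r, is_root r;
  tree_countable : countable [set: T];
  tree_no_path : ~ exists f : nat -> T, forall i, prec (f i) (f i.+1) }.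

Definition level x (n : nat) : Prop := [set y | prec y x] #= `I_n.

Definition immediate_succ x y : Prop :=
  prec x y /\ ~ exists z, prec x z /\ prec z y.

(* The last premise says that [a] is the supremum of the [rk y + 1]. *)
Inductive has_rank x (a : ord) : Prop :=
| HasRank (rk : T -> ord) of
    (forall y, immediate_succ x y -> has_rank y (rk y)) &
    (forall b, ole a b <-> forall y, immediate_succ x y -> olt (rk y) b).

Definition tree_rank (a : ord) : Prop := exists r, is_root r /\ has_rank r a.

Definition subtree x : structure :=
  @Structure (sig (fun y : T => y = x \/ prec x y))
    (fun u v => prec (sval u) (sval v)).

End Trees.

(* An element of omega + 1: [None] stands for omega. *)
Definition omega1 := option nat.
Definition omega : omega1 := None.

Definition of_card (N : omega1) : set nat :=
  if N is Some k then `I_k else [set: nat].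

(* [T] is a copy of the tree [n : N], which is defined for n >= 1 only; such
   trees exist by [tree_type_exists] below. *)
Fixpoint tree_type (n : nat) (N : omega1) (T : structure) {struct n} : Prop :=
  match n with
  | 0 => False
  | 1 => [/\ is_tree T,
             exists2 a, tree_rank T a & ole a (ofin 1) &
             exists2 r : T, is_root r &
               [set x | immediate_succ r x] #= of_card N]
  | n'.+1 =>
    [/\ is_tree T,
        tree_rank T (ofin n),
        [set x : T | level x 1 /\ tree_type n' omega (subtree x)] #= of_card N,
        (forall k : nat,
           [set x : T | level x 1 /\ tree_type n' (Some k) (subtree x)]
             #= [set: nat]) &
        (forall x : T, level x 1 ->
           exists M : omega1, tree_type n' M (subtree x))]
  end.

(* [form n] is the type of formulas with free variables among 'I_n. The
   quantifiers bind variable [ord0] and shift the others by one. Countable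
   disjunctions and conjunctions are indexed by nat; finite ones are obtained
   by repetition, the empty ones from [FFalse] and its negation. *)
Inductive form (n : nat) : Type :=
| FFalse
| FPrec of 'I_n & 'I_n
| FEq of 'I_n & 'I_n
| FNot of form n
| FAnd of form n & form n
| FOr of form n & form n
| FConj of (nat -> form n)
| FDisj of (nat -> form n)
| FAll of form n.+1
| FEx of form n.+1.

Arguments FFalse {n}.

Definition vcons (A : Type) n (a : A) (v : 'I_n -> A) : 'I_n.+1 -> A :=
  fun i => oapp v a (unlift ord0 i).

Fixpoint sat (A : structure) n (phi : form n) : ('I_n -> A) -> Prop :=
  match phi with
  | FFalse => fun _ => False
  | FPrec i j => fun v => prec (v i) (v j)
  | FEq i j => fun v => v i = v j
  | FNot p => fun v => ~ sat p v
  | FAnd p q => fun v => sat p v /\ sat q v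
  | FOr p q => fun v => sat p v \/ sat q v
  | FConj p => fun v => forall i, sat (p i) v
  | FDisj p => fun v => exists i, sat (p i) v
  | FAll p => fun v => forall a, sat p (vcons a v)
  | FEx p => fun v => exists a, sat p (vcons a v)
  end.

Definition sentence := form 0.

Definition vnil (A : Type) : 'I_0 -> A :=
  fun i => False_rect A (elimF idP (erefl : (i < 0) = false) (ltn_ord i)).

Definition models (A : structure) (phi : sentence) : Prop :=
  sat phi (@vnil A).

Fixpoint quantifier_free n (phi : form n) : Prop :=
  match phi with
  | FFalse | FPrec _ _ | FEq _ _ => True
  | FNot p => quantifier_free p
  | FAnd p q | FOr p q => quantifier_free p /\ quantifier_free q
  | FConj _ | FDisj _ | FAll _ | FEx _ => False
  end.

Fixpoint ex_block n k : form (k + n) -> form n :=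
  match k with
  | 0 => id
  | k'.+1 => fun phi => ex_block (FEx phi)
  end.

Fixpoint all_block n k : form (k + n) -> form n :=
  match k with
  | 0 => id
  | k'.+1 => fun phi => all_block (FAll phi)
  end.

Inductive Sigma_in (n : nat) (a : ord) : form n -> Prop :=
| Sigma_zero phi of ole a Ozero & quantifier_free phi : Sigma_in a phi
| Sigma_pos (k : nat -> nat) (b : nat -> ord)
    (psi : forall i, form (k i + n)) of
    olt Ozero a & (forall i, olt (b i) a) & (forall i, Pi_in (b i) (psi i)) :
    Sigma_in a (FDisj (fun i => ex_block (psi i)))
with Pi_in (n : nat) (a : ord) : form n -> Prop :=
| Pi_zero phi of ole a Ozero & quantifier_free phi : Pi_in a phi
| Pi_pos (k : nat -> nat) (b : nat -> ord)
    (psi : forall i, form (k i + n)) of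
    olt Ozero a & (forall i, olt (b i) a) & (forall i, Sigma_in (b i) (psi i)) :
    Pi_in a (FConj (fun i => all_block (psi i))).

Inductive complexity : Type :=
| CSigma of ord
| CPi of ord
| CdSigma of ord.

Definition has_complexity (c : complexity) n (phi : form n) : Prop :=
  match c with
  | CSigma a => Sigma_in a phi
  | CPi a => Pi_in a phi
  | CdSigma a => exists2 p, Sigma_in a p & exists2 q, Pi_in a q & phi = FAnd p q
  end.

Definition complexity_ord (c : complexity) : ord :=
  match c with CSigma a | CPi a | CdSigma a => a end.

Definition complexity_le (c d : complexity) : Prop :=
  let a := complexity_ord c in
  let b := complexity_ord d in
  match c, d with
  | CSigma _, CSigma _ | CPi _, CPi _ | _, CdSigma _ => ole a b
  | _, _ => olt a b
  end.

(* Structures are nonempty, and [countable] includes finite. *)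
Definition scott_sentence (A : structure) (phi : sentence) : Prop :=
  forall B : structure, inhabited B -> countable [set: B] ->
    (models B phi <-> isomorphic A B).

Definition has_scott_sentence (A : structure) (c : complexity) : Prop :=
  exists2 phi, has_complexity c phi & scott_sentence A phi.

Definition SSC (A : structure) (c : complexity) : Prop :=
  has_scott_sentence A c /\
  forall d, has_scott_sentence A d -> complexity_le c d.

Lemma ole_refl a : ole a a.
Proof.
elim: a => [|a IH|f IH]; first exact: ole_zero; first exact: ole_succ.
by apply: sup_ole => i; apply: ole_sup (IH i).
Qed.

Lemma bij_card (A B : Type) (f : A -> B) (P : set A) (Q : set B) :
  bijective f -> (forall x, P x <-> Q (f x)) -> P #= Q.
Proof.
move=> [g fK gK] PQ; have -> : Q = f @` P.
  apply/seteqP; split=> [y Qy|_ [x Px <-]]; last exact/PQ.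
  by exists (g y); rewrite ?gK//; apply/PQ; rewrite gK.
by apply/card_esym/inj_card_eq; apply: in2W; apply: can_inj fK.
Qed.

Section Iso.
Variables (A B : structure) (f : A -> B) (g : B -> A).
Hypotheses (fK : cancel f g) (gK : cancel g f).
Hypothesis fP : forall x y, prec x y <-> prec (f x) (f y).

Let f_bij : bijective f. Proof. by exists g. Qed.

Lemma iso_prec x y : prec (g x) (g y) <-> prec x y.
Proof. by rewrite fP !gK. Qed.

Lemma iso_root x : is_root x -> is_root (f x).
Proof.
move=> rx y; case: (rx (g y)) => [<-|/fP]; rewrite gK; by [left|right].
Qed.

Lemma iso_succ x y : immediate_succ x y <-> immediate_succ (f x) (f y).
Proof.
split=> -[xy nz]; (split; first exact/fP); move=> [z [xz zy]]; apply: nz.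
  by exists (g z); split; apply/fP; rewrite gK.
by exists (f z); split; apply/fP.
Qed.

Lemma iso_rank x a : has_rank x a -> has_rank (f x) a.
Proof.
move=> h; elim: h => {}x {}a rk _ IH sup; apply: (HasRank (rk := rk \o g)).
  move=> y; rewrite -{1}[y]gK => /iso_succ /IH; by rewrite gK.
move=> b; rewrite sup; split=> h y xy; last first.
  by have := h (f y); rewrite /= fK; apply; apply/iso_succ.
by apply: h; apply/iso_succ; rewrite gK.
Qed.

Lemma iso_tree_rank a : tree_rank A a -> tree_rank B a.
Proof.
by move=> [r [/iso_root rr /iso_rank ra]]; exists (f r).
Qed.

Lemma iso_level x n : level x n <-> level (f x) n.
Proof.
have e : [set y | prec y x] #= [set y | prec y (f x)].
  by apply: (bij_card f_bij) => y; apply: fP.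
by rewrite /level (card_eql e).
Qed.

Lemma iso_is_tree : is_tree A -> is_tree B.
Proof.
move=> tA; split=> [x|x y z|x|x y z|||].
- by rewrite -iso_prec; apply: (tree_irr tA).
- by rewrite -!iso_prec; apply: (tree_trans tA).
- have [n hn] := tree_finite tA (g x); exists n.
  apply: card_eq_trans hn; apply: card_esym; apply: (bij_card f_bij) => y.
  by rewrite -{2}[x]gK; apply: fP.
- rewrite -!iso_prec => yx zx.
  case: (tree_linear tA yx zx) => [?|[/(congr1 f)|?]]; [by left| |by right;right].
  by rewrite !gK; right; left.
- by have [r /iso_root] := tree_root tA; exists (f r).
- have e : [set: B] #= [set: A].
    by apply: card_esym; apply: (bij_card f_bij).
  by rewrite (eq_countable e); apply: tree_countable tA.
- move=> [p hp]; apply: (tree_no_path tA); exists (g \o p) => i.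
  exact/iso_prec.
Qed.

Lemma iso_subtree x : isomorphic (subtree x) (subtree (f x)).
Proof.
have h1 y : (y = x \/ prec x y) <-> (f y = f x \/ prec (f x) (f y)).
  by split=> -[e|/fP]; [left; rewrite e|right|left; apply: (can_inj fK)|right].
have h2 y : (y = f x \/ prec (f x) y) -> (g y = x \/ prec x (g y)).
  by move=> h; apply/h1; rewrite gK.
exists (fun y : subtree x => exist _ (f (sval y)) (proj1 (h1 _) (svalP y))
   : subtree (f x)); split; last by move=> y z; apply: fP.
exists (fun y : subtree (f x) => exist _ (g (sval y)) (h2 _ (svalP y))
   : subtree x) => -[y hy]; apply: eq_exist; [exact: fK|exact: gK].
Qed.

End Iso.

Lemma isomorphic_sym A B : isomorphic A B -> isomorphic B A.
Proof.
move=> [f [[g fK gK] fP]]; exists g; split; first by exists f.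
by move=> x y; rewrite fP !gK.
Qed.

Lemma tree_type_iso n N A B :
  isomorphic A B -> tree_type n N A -> tree_type n N B.
Proof.
elim: n N A B => [//|n IH] N A B [f [[g fK gK] fP]].
have fbij : bijective f by exists g.
case: n IH => [_ [tA [a ra a1] [r rr hr]]|n IH [tA rA h1 h2 h3]].
  split; first exact: iso_is_tree tA.
    by exists a => //; apply: iso_tree_rank ra.
  exists (f r); first exact: iso_root rr.
  apply: card_eq_trans hr; apply: card_esym; apply: (bij_card fbij) => y.
  exact: iso_succ.
have e M x : level x 1 /\ tree_type n.+1 M (subtree x) <->
    level (f x) 1 /\ tree_type n.+1 M (subtree (f x)).
  have := iso_subtree fK gK fP x => i; have := isomorphic_sym i => i'.
  split=> -[/(iso_level fK gK fP) l t]; split=> //; exact: IH t.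
split; first exact: iso_is_tree tA.
- exact: iso_tree_rank rA.
- apply: card_eq_trans h1; apply: card_esym; exact: (bij_card fbij) (e _).
- move=> k; apply: card_eq_trans (h2 k); apply: card_esym.
  exact: (bij_card fbij) (e _).
- move=> x; rewrite -[x]gK => /(iso_level fK gK fP) l.
  by have [M t] := h3 _ l; exists M; have [] := proj1 (e M (g x)) (conj l t).
Qed.

(* The tree in which the subtrees above the root are the [F i]. *)
Section Graft.
Variables (I : Type) (F : I -> structure).

Inductive graft_prec : option {i : I & F i} -> option {i : I & F i} -> Prop :=
| graft_root p : graft_prec None (Some p)
| graft_sub i (x y : F i) of prec x y :
    graft_prec (Some (existT _ i x)) (Some (existT _ i y)).

Definition graft : structure := Structure graft_prec.

Hypothesis cI : countable [set: I].
Hypothesis tF : forall i, is_tree (F i).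

Let inj i (x : F i) : graft := Some (existT _ i x).

Lemma inj_inj i : injective (@inj i).
Proof.
move=> x y [e]; rewrite -[x]/(projT2 (existT F i x)) -[y]/(projT2 (existT F i y)).
have := projT2_eq e; rewrite (Prop_irrelevance (projT1_eq e) erefl); exact.
Qed.

Lemma graft_below i (x : F i) y : prec y (inj x) <->
  y = None \/ exists2 z : F i, y = inj z & prec z x.
Proof.
split=> [h|[->|[z -> zx]]]; [|exact: graft_root|exact: graft_sub].
move: h; rewrite /prec /=; set t := inj x => h.
have e : t = inj x by [].
case: h e => [p|j u v uv] e; [by left|right].
have ij : j = i by case: e.
by case: _ / ij x @t e => x t /inj_inj <-; exists u.
Qed.

Lemma graftP (p : graft) : p = None \/ exists i (x : F i), p = inj x.
Proof. by case: p => [[i x]|]; [right; exists i, x|left]. Qed.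

Lemma prec_None (p : graft) : ~ prec p None.
Proof. by move=> h; inversion h. Qed.

Lemma prec_inj i (x y : F i) : prec (inj x) (inj y) <-> prec x y.
Proof.
by split=> [/graft_below[//|[z /inj_inj ->]]|xy] //; apply: graft_sub.
Qed.

Lemma graft_above i (x : F i) q :
  prec (inj x) q <-> exists2 y : F i, q = inj y & prec x y.
Proof.
split=> [|[y -> /prec_inj]//].
case: (graftP q) => [->/prec_None//|[j [y ->]]] /graft_below[//|[z e zy]].
have ij : i = j by case: e.
case: _ / ij y z e zy => y z /inj_inj -> xy; by exists y.
Qed.

Lemma graft_is_root : is_root (None : graft).
Proof. by case=> [p|]; [right; apply: graft_root|left]. Qed.

Lemma graft_countable : countable [set: graft].
Proof.
have -> : [set: graft] = [set None] `|` \bigcup_(i in setT) range (@inj i).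
  apply/seteqP; split=> // p _; case: (graftP p) => [->|[i [x ->]]]; first by left.
  by right; exists i => //; exists x.
rewrite -bigcup2E; apply: bigcup_countable => // -[|[|n]] _ //=.
apply: bigcup_countable => // i _; apply: sub_countable (tree_countable (tF i)).
exact: card_image_le.
Qed.

Lemma graft_is_tree : is_tree graft.
Proof.
split.
- move=> p; case: (graftP p) => [->/prec_None//|[i [x ->]]] /prec_inj.
  exact: (tree_irr (tF i)).
- move=> p q s; case: (graftP p) => [->|[i [x ->]]].
    by case: s => [s|] _; [move=> _; apply: graft_root|move/prec_None].
  move=> /graft_above[y -> xy] /graft_above[z -> yz].
  apply/prec_inj; exact: (tree_trans (tF i)) yz.
- move=> p; case: (graftP p) => [->|[i [x ->]]].
    have -> : [set y : graft | prec y None] = set0.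
      by apply/seteqP; split=> // y /prec_None.
    exact: finite_set0.
  have -> : [set y : graft | prec y (inj x)]
      = [set None] `|` @inj i @` [set y | prec y x].
    apply/seteqP; split=> [y /graft_below[->|[z -> zx]]|y].
    + by left.
    + by right; exists z.
    + by case=> [->|[z zx <-]]; apply/graft_below; [left|right; exists z].
  rewrite finite_setU; split; first exact: finite_set1.
  apply: finite_image; exact: tree_finite.
- move=> p q s; case: (graftP p) => [->/prec_None//|[i [x ->]]].
  move=> /graft_below[->|[y -> yx]] /graft_below[->|[z -> zx]].
  + by right; left.
  + by left; apply: graft_root.
  + by right; right; apply: graft_root.
  + case: (tree_linear (tF i) yx zx) => [h|[->|h]].
    * by left; apply/prec_inj.
    * by right; left.
    * by right; right; apply/prec_inj.
- by exists None; apply: graft_is_root.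
- exact: graft_countable.
- move=> [p hp]; have := hp 0; case: (graftP (p 1)) => [->/prec_None//|].
  move=> [i [x e]] _.
  have /choice[y hy] : forall n, exists y : F i, p n.+1 = inj y.
    elim=> [|n [y hy]]; first by exists x.
    by have := hp n.+1; rewrite hy => /graft_above[z -> _]; exists z.
  apply: (tree_no_path (tF i)); exists y => n; apply/prec_inj.
  by rewrite -!hy.
Qed.

Variable r : forall i, F i.
Hypothesis rF : forall i, is_root (r i).

Definition graft_node i : graft := inj (r i).

Lemma graft_node_inj : injective graft_node.
Proof. by move=> i j []. Qed.

Lemma root_min i x : ~ prec x (r i).
Proof.
move=> h; case: (rF x) => [e|e].
  by rewrite e in h; exact: (tree_irr (tF i)) h.
exact: (tree_irr (tF i)) (tree_trans (tF i) h e).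
Qed.

Lemma graft_level p : level p 1 <-> exists i, p = graft_node i.
Proof.
split=> [|[i ->]]; last first.
  rewrite /level.
  suff -> : [set y : graft | prec y (graft_node i)] = [set None].
    exact: card_set1.
  apply/seteqP; split=> [y /graft_below[//|[z _ /root_min]//]|y ->].
  exact: graft_root.
case: (graftP p) => [->|[i [x ->]]]; rewrite /level => h.
  move: h; have -> : [set y : graft | prec y None] = set0.
    by apply/seteqP; split=> // y /prec_None.
  by rewrite card_eq_sym card_eq0 => /eqP /seteqP[/(_ 0 erefl)].
exists i; case: (rF x) => [->//|rx].
have : [set None; graft_node i] #<= `I_1.
  rewrite -(card_le_eqr h); apply: subset_card_le => y [->|->].
    exact: graft_root.
  exact/prec_inj.
have -> : [set None; graft_node i] = (fun k => if k is 0 then None else graft_node i) @` `I_2.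
  apply/seteqP; split=> [y [->|->]|y [[|[|k]] //= _ <-]].
  - by exists 0.
  - by exists 1.
  - by left.
  - by right.
rewrite (card_le_eql (inj_card_eq _)) ?card_le_II//.
by move=> [|[|?]] [|[|?]]; rewrite !inE.
Qed.

Lemma graft_succ_None p :
  @immediate_succ graft None p <-> exists i, p = graft_node i.
Proof.
split=> [[]|[i ->]]; last first.
  split; first exact: graft_root.
  move=> [z [h /graft_below[e|[y _ /root_min//]]]].
  by rewrite e in h; exact: prec_None h.
case: (graftP p) => [->/prec_None//|[i [x ->]]] _ nz; exists i.
case: (rF x) => [->//|rx]; case: nz; exists (graft_node i).
by split; [apply: graft_root|apply/prec_inj].
Qed.

Lemma graft_succ i (x : F i) p : immediate_succ (inj x) p <->
  exists2 y, p = inj y & immediate_succ x y.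
Proof.
split=> [[/graft_above[y -> xy] nz]|[y -> [xy nz]]].
  exists y => //; split=> // -[z [xz zy]]; apply: nz.
  by exists (inj z); split; apply/prec_inj.
split; first exact/prec_inj.
move=> [q [/graft_above[z -> xz] /prec_inj zy]]; apply: nz; by exists z.
Qed.

Lemma graft_rank i (x : F i) a : has_rank x a -> has_rank (inj x) a.
Proof.
elim=> {}x {}a rk _ IH sup.
have /choice[rk' h'] : forall p, exists o, forall y, p = inj y -> o = rk y.
  move=> p; have [[y ->]|n] := pselect (exists y : F i, p = inj y).
    by exists (rk y) => z /inj_inj ->.
  by exists Ozero => y e; case: n; exists y.
apply: (HasRank (rk := rk')) => [p /graft_succ[y -> xy]|b].
  by rewrite (h' _ _ erefl); apply: IH.
rewrite sup; split=> h y; last first.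
  by move=> xy; rewrite -(h' _ _ erefl); apply: h; apply/graft_succ; exists y.
by move=> /graft_succ[z -> xz]; rewrite (h' _ _ erefl); apply: h.
Qed.

Lemma graft_rank_None (b : I -> ord) a : (forall i, has_rank (r i) (b i)) ->
  (forall c, ole a c <-> forall i, olt (b i) c) -> tree_rank graft a.
Proof.
move=> hb sup; exists None; split; first exact: graft_is_root.
pose rk (p : graft) := if p is Some s then b (tag s) else Ozero.
apply: (HasRank (rk := rk)) => [p /graft_succ_None[i ->]|c].
  exact: graft_rank.
rewrite sup; split=> h; first by move=> p /graft_succ_None[i ->]; apply: h.
by move=> i; apply: (h (graft_node i)); apply/graft_succ_None; exists i.
Qed.

Lemma graft_subtree i : isomorphic (F i) (subtree (graft_node i)).
Proof.
have h (x : F i) : inj x = graft_node i \/ prec (graft_node i) (inj x).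
  by case: (rF x) => [->|rx]; [left|right; apply/prec_inj].
pose f (x : F i) : subtree (graft_node i) := exist _ (inj x) (h x).
have finj : injective f by move=> x y /(congr1 sval) /inj_inj.
have /choice[g gK] : forall y, exists x, f x = y.
  move=> [y hy]; have [x e] : exists x : F i, y = inj x.
    case: (hy) => [->|]; first by exists (r i).
    by rewrite graft_above => -[x -> _]; exists x.
  by exists x; apply: eq_exist; rewrite e.
exists f; split; last by move=> x y; apply: iff_sym; apply: prec_inj.
by exists g => x; [apply: finj|]; rewrite gK.
Qed.

Lemma graft_card (P : graft -> Prop) (J : set I) :
  (forall i, P (graft_node i) <-> J i) ->
  [set x : graft | level x 1 /\ P x] #= J.
Proof.
move=> PJ; have -> : [set x : graft | level x 1 /\ P x] = graft_node @` J.
  apply/seteqP; split=> [p [/graft_level[i ->] /PJ]|p [i /PJ Pi <-]].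
    by exists i.
  by split=> //; apply/graft_level; exists i.
by apply: inj_card_eq; apply: in2W; apply: graft_node_inj.
Qed.

End Graft.

Lemma ole_trans a b c : ole a b -> ole b c -> ole a c.
Proof.
move=> h; elim: h c => {a b} [b c _|a b _ IH c|a f i _ IH c|f b _ IH c bc].
- exact: ole_zero.
- move e: (Osucc b) => b' h; elim: h e => {b' c} [//|b' c bc _ [eb]|b' f i _ h e|//].
    by apply: ole_succ; apply: IH; rewrite eb.
  by apply: (ole_sup (i := i)); apply: h.
- move e: (Osup f) => b' h; elim: h e => {b' c} [//|//|b' g j _ h e|g c h _ [e]].
    by apply: (ole_sup (i := j)); apply: h.
  by apply: IH; rewrite e.
- by apply: sup_ole => i; apply: IH.
Qed.

Lemma of_card_inj M N : of_card M #= of_card N -> M = N.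
Proof.
case: M N => [m|] [n|] //= => [/card_eq_II->//|h|h]; exfalso;
  apply: infinite_nat; first by exists m; apply: card_esym.
by exists n.
Qed.

Lemma tree_type_inj n M N T : tree_type n M T -> tree_type n N T -> M = N.
Proof.
case: n => [//|[|n]] /=; last first.
  move=> [_ _ h _ _] [_ _ h' _ _]; apply: of_card_inj.
  exact: card_eq_trans (card_esym h) h'.
move=> [tT _ [r rr h]] [_ _ [r' rr' h']]; apply: of_card_inj.
apply: card_eq_trans (card_esym h) _.
case: (rr r') => [<-//|rr1]; case: (rr' r) => [->//|r1r].
by case: (tree_irr tT (tree_trans tT rr1 r1r)).
Qed.

Definition point : structure := Structure (fun _ _ : unit => False).

Lemma point_is_tree : is_tree point.
Proof.
split; try by [move=> x []|move=> x y z []].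
- move=> x; have -> : [set y : point | prec y x] = set0 by apply/seteqP; split.
  exact: finite_set0.
- by exists tt => -[]; left.
- exact: countableP.
- by move=> [f /(_ 0)].
Qed.

Section Model.
Variable N : omega1.
Definition card_index := set_type (of_card N).
Definition child_index := (card_index + nat * nat)%type.
Definition child_type (s : child_index) : omega1 :=
  match s with inl _ => omega | inr p => Some p.1 end.
End Model.

Fixpoint tree_model (n : nat) (N : omega1) : structure :=
  match n with
  | 0 => point
  | 1 => graft (fun _ : card_index N => point)
  | n'.+1 => graft (fun s : child_index N => tree_model n' (child_type s))
  end.

Definition model_rank (n : nat) (N : omega1) : ord :=
  if (n, N) is (1, Some 0) then Ozero else ofin n.

Lemma card_index_countable N : countable [set: card_index N].
Proof. by rewrite /countable (card_le_eql (card_setT _)); exact: countableP. Qed.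

Lemma card_index_card N : [set: card_index N] #= of_card N.
Proof. exact: card_setT. Qed.

Lemma child_index_countable N : countable [set: child_index N].
Proof.
have -> : [set: child_index N] = range inl `|` range inr.
  by apply/seteqP; split=> // -[x|x] _; [left|right]; exists x.
rewrite -bigcup2E; apply: bigcup_countable => // -[|[|n]] _ //=.
  by apply: sub_countable (card_index_countable N); apply: card_image_le.
by apply: sub_countable (card_image_le _ _) _; exact: countableP.
Qed.

Lemma card_index0 N : N <> Some 0 -> exists s : card_index N, True.
Proof.
move=> N0; have h : 0 \in of_card N.
  by rewrite inE; case: N N0 => [[|k]|].
by exists (exist _ 0 h).
Qed.

Theorem tree_model_type n N : tree_type n.+1 N (tree_model n.+1 N) /\
  tree_rank (tree_model n.+1 N) (model_rank n.+1 N).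
Proof.
elim: n N => [|n IH] N.
  have pT (i : card_index N) := point_is_tree.
  have pr (i : card_index N) : @is_root point tt by case; left.
  have rk : tree_rank (tree_model 1 N) (model_rank 1 N).
    apply: (graft_rank_None pT pr (b := fun _ => Ozero)).
      move=> i; apply: (HasRank (rk := fun _ => Ozero)) => [y []//|b].
      by split=> [_ y []|_]; try exact: ole_zero.
    move=> c; have [->|N0] := pselect (N = Some 0).
      split=> [_ i|_]; last exact: ole_zero.
      by have := svalP i; rewrite inE.
    have -> : model_rank 1 N = ofin 1 by case: N N0 {pT pr} => [[|k]|].
    by split=> [//|h]; have [s _] := card_index0 N0; apply: (h s).
  split=> //; split; first exact: (graft_is_tree (card_index_countable N) pT).
    exists (model_rank 1 N) => //; rewrite /model_rank.
    by case: N {pT pr rk} => [[|k]|]; [exact: ole_zero|exact: ole_refl..].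
  exists None; first exact: graft_is_root.
  apply: card_eq_trans (card_index_card N).
  suff -> : [set x : tree_model 1 N | @immediate_succ (tree_model 1 N) None x]
     = range (@graft_node _ (fun=> point) (fun=> tt)).
    by apply: inj_card_eq; apply: in2W; apply: graft_node_inj.
  apply/seteqP; split=> [p /(graft_succ_None pT pr)[i ->]|p [i _ <-]].
    by exists i.
  by apply/(graft_succ_None pT pr); exists i.
pose F (s : child_index N) := tree_model n.+1 (child_type s).
have FT s : tree_type n.+1 (child_type s) (F s) by exact: (IH _).1.
have tF s : is_tree (F s) by have := FT s; case: (n) => [|k] [].
have /(_ _)/cid hr s : exists x : F s,
    is_root x /\ has_rank x (model_rank n.+1 (child_type s)).
  by have [_ [x []]] := IH (child_type s); exists x.
pose r s := projT1 (hr s).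
have rF s : is_root (r s) by exact: (projT2 (hr s)).1.
have rR s : has_rank (r s) (model_rank n.+1 (child_type s)).
  exact: (projT2 (hr s)).2.
have rk : tree_rank (graft F) (ofin n.+2).
  apply: (graft_rank_None tF rF rR) => c; split=> [h s|h]; last first.
    have := h (inr (1, 0)); by rewrite /model_rank; case: (n).
  apply: ole_trans h; rewrite /model_rank; apply: ole_succ.
  case: (n) => [|k]; last exact: ole_refl.
  by case: (child_type s) => [[|k]|]; [exact: ole_zero|exact: ole_refl..].
have ty M s : tree_type n.+1 M (subtree (graft_node r s)) <-> child_type s = M.
  have i := graft_subtree rF s; split=> [h|<-]; last exact: tree_type_iso i (FT s).
  by apply: tree_type_inj (FT s) (tree_type_iso (isomorphic_sym i) h).
split; last exact: rk.
split; [exact: (graft_is_tree (child_index_countable N) tF)|exact: rk|..].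
- apply: card_eq_trans (graft_card (J := [set s | child_type s = omega])
    tF rF (ty omega)) _.
  apply: card_eq_trans (card_index_card N).
  have -> : [set s : child_index N | child_type s = omega] = range inl.
    by apply/seteqP; split=> [[s|s] //= _|s [i _ <-]//]; exists s.
  by apply: inj_card_eq; apply: in2W => x y [].
- move=> k; apply: card_eq_trans (graft_card (J := [set s | child_type s = Some k])
    tF rF (ty (Some k))) _.
  have -> : [set s : child_index N | child_type s = Some k]
      = range (fun j => inr (k, j)).
    apply/seteqP; split=> [[s|[l j]] //= [<-]|s [j _ <-]//]; by exists j.
  by apply: inj_card_eq; apply: in2W => x y [].
- move=> p /(graft_level tF rF)[s ->]; exists (child_type s); exact/ty.
Qed.

Corollary tree_type_exists n N : 0 < n -> exists T, tree_type n N T.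
Proof.
case: n => // n _; exists (tree_model n.+1 N); exact: (tree_model_type n N).1.
Qed.

(* Main.v *)
Require Import Defs.
From mathcomp Require Import all_boot.
From mathcomp Require Import boolp classical_sets functions cardinality.

Set Implicit Arguments.
Unset Strict Implicit.
Unset Printing Implicit Defensive.

Local Open Scope classical_set_scope.
Local Open Scope card_scope.

(** Write [n : N] for the tree type, [n = m + 1].

The lower bound is a back-and-forth argument.  Let (A, v) <=_l (B, w) mean that
every Pi_l formula true of the tuple v in A is true of w in B.  The key fact is
[back_forth_omega_fin]: if v has at most k entries, then some tuple w satisfies
([n : omega], v) <=_(2n-1) ([n : k], w).  By induction on n.  Embed [n : k] in
[n : omega] as a union of branches containing v, and let w be the preimage of v.
If the opponent adds points of [n : k], copy them along the embedding.  If she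
then adds points of [n : omega], she may use branches [n-1 : omega] outside the
image; match each of them with a fresh branch [n-1 : j], where j exceeds the
number of points chosen so far, and apply the induction hypothesis to these two
branches: it covers the 2n-3 rounds that remain.  Since [n-1 : j] occurs
infinitely often in both trees, a bijection of the branches absorbs the surplus.

A Sigma_(2n) sentence true in [n : omega] asserts a Pi_(2n-1) formula of some
tuple v, hence is true in the non-isomorphic tree [n : k] for large k; the
same choice of v and k refutes d-Sigma_(2n-1) sentences.  So every Scott
sentence of [n : omega] is at least Pi_(2n) ([SSC_lower_bound]).

For the upper bound, having k children of type [n-1 : omega] is a Sigma_(2n-1)
property of the root of a tree of height at most n, provided that its branches
are of the right kind: the type [n : omega] is the conjunction of these
properties for all k, hence Pi_(2n), and being of some type [n : N] is
Pi_(2n-1), because the types [n-1 : k] are differences of Sigma_(2n-3)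
properties ([definable_at_least], [definable_regular]).  Asking in addition for
a tree of bounded height costs Pi_3, which is below Pi_(2n) as n > 1.  A
countable structure with these properties is isomorphic to [n : omega] because
tree types determine countable trees ([tree_type_model]). *)

(** * Comparing countable ordinals with finite ones *)

Lemma ole_succ_inv a b : ole (Osucc a) (Osucc b) -> ole a b.
Proof.
move e: (Osucc a) => a' h.
suff: ole a' (Osucc b) -> ole a b by apply.
by rewrite -e => h'; inversion h'.
Qed.

Lemma ole_succ_zero a : ~ ole (Osucc a) Ozero.
Proof. by move=> h; inversion h. Qed.

Lemma ole_ofin_total n a : ole a (ofin n) \/ ole (ofin n.+1) a.
Proof.
elim: n a => [|n IHn] a; elim: a => [|a IHa|f IHf].
- by left; apply: ole_zero.
- by right; apply/ole_succ/ole_zero.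
- have [[i hi]|h] := pselect (exists i, ole (ofin 1) (f i)).
    by right; apply: ole_sup hi.
  by left; apply: sup_ole => i; case: (IHf i) => // hi; case: h; exists i.
- by left; apply: ole_zero.
- by case: (IHn a) => h; [left|right]; apply: ole_succ.
- have [[i hi]|h] := pselect (exists i, ole (ofin n.+2) (f i)).
    by right; apply: ole_sup hi.
  by left; apply: sup_ole => i; case: (IHf i) => // hi; case: h; exists i.
Qed.

Lemma olt_ofin b a l : olt b a -> ole a (ofin l.+1) -> ole b (ofin l).
Proof. by move=> ba al; apply: ole_succ_inv; apply: ole_trans ba al. Qed.

Lemma ole_ofin m n : m <= n -> ole (ofin m) (ofin n).
Proof.
elim: m n => [|m IH] [|n] //= mn; [exact: ole_zero..|].
by apply: ole_succ; apply: IH.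
Qed.

(** * Blocks of variables *)

Section Tuples.
Variable A : Type.
Implicit Types (m n k : nat).

(** The new entries come first, as they do for the bound variables of
[ex_block] and [all_block]. *)
Definition vcat k n (w : 'I_k -> A) (v : 'I_n -> A) : 'I_(k + n) -> A :=
  fun i => match fintype.split i with inl a => w a | inr b => v b end.

Lemma vcat_lshift k n (w : 'I_k -> A) (v : 'I_n -> A) i :
  vcat w v (lshift n i) = w i.
Proof. by rewrite /vcat; have := fintype.unsplitK (inl i : 'I_k + 'I_n); move=> /= ->. Qed.

Lemma vcat_rshift k n (w : 'I_k -> A) (v : 'I_n -> A) i :
  vcat w v (rshift k i) = v i.
Proof. by rewrite /vcat; have := fintype.unsplitK (inr i : 'I_k + 'I_n); move=> /= ->. Qed.

Lemma vcat_ext k n (u : 'I_(k + n) -> A) (w : 'I_k -> A) (v : 'I_n -> A) :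
  (forall i, u (lshift n i) = w i) -> (forall i, u (rshift k i) = v i) ->
  u = vcat w v.
Proof.
move=> hl hr; apply: funext => i; rewrite -(fintype.splitK i) /unsplit.
by case: (fintype.split i) => a; rewrite (vcat_lshift, vcat_rshift).
Qed.

Lemma vcat_split k n (u : 'I_(k + n) -> A) :
  u = vcat (fun i => u (lshift n i)) (fun i => u (rshift k i)).
Proof. exact: vcat_ext. Qed.

Lemma vcat_cons k n a (w : 'I_k -> A) (v : 'I_n -> A) :
  vcons a (vcat w v) = vcat (vcons a w) v.
Proof.
apply: (@vcat_ext k.+1) => i.
  case: (unliftP ord0 i) => [j|] ->.
    have -> : lshift n (lift ord0 j) = lift ord0 (lshift n j) by apply: val_inj.
    by rewrite /vcons !liftK /= vcat_lshift.
  have -> : lshift n (ord0 : 'I_k.+1) = ord0 by apply: val_inj.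
  by rewrite /vcons !unlift_none.
have -> : rshift k.+1 i = lift ord0 (rshift k i) by apply: val_inj.
by rewrite /vcons liftK /= vcat_rshift.
Qed.

Lemma vcons_eta k (w : 'I_k.+1 -> A) :
  w = vcons (w ord0) (fun i => w (lift ord0 i)).
Proof.
apply: funext => i; rewrite /vcons.
by case: (unliftP ord0 i) => [j|] ->.
Qed.

Lemma vcat0 n (w : 'I_0 -> A) (v : 'I_n -> A) : vcat w v = v.
Proof. by symmetry; apply: (@vcat_ext 0) => -[]// i hi; congr v; apply: val_inj. Qed.

End Tuples.

Lemma vcat_comp (A B : Type) (f : A -> B) k n (w : 'I_k -> A) (v : 'I_n -> A) :
  f \o vcat w v = vcat (f \o w) (f \o v).
Proof. by apply: vcat_ext => i /=; rewrite (vcat_lshift, vcat_rshift). Qed.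

Definition lift_index k m n (s : 'I_m -> 'I_n) : 'I_(k + m) -> 'I_(k + n) :=
  vcat (lshift n) (fun i => rshift k (s i)).

Lemma vcat_lift_index (A : Type) k m n (s : 'I_m -> 'I_n) (w : 'I_k -> A) v :
  vcat w v \o lift_index s = vcat w (v \o s).
Proof.
rewrite /lift_index vcat_comp; apply: vcat_ext => i.
  by rewrite vcat_lshift /= vcat_lshift.
by rewrite vcat_rshift /= vcat_rshift.
Qed.

Lemma sat_all_block (A : structure) n k (phi : form (k + n)) (v : 'I_n -> A) :
  sat (all_block phi) v <-> forall w, sat phi (vcat w v).
Proof.
elim: k phi => [|k IH] phi /=.
  by split=> [h w|/(_ (@vnil A))]; rewrite vcat0; [exact: h|move=> h; exact: h].
rewrite IH; split=> [h w|h w a]; last by rewrite vcat_cons; apply: h.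
by rewrite (vcons_eta w) -vcat_cons; apply: h.
Qed.

Lemma sat_ex_block (A : structure) n k (phi : form (k + n)) (v : 'I_n -> A) :
  sat (ex_block phi) v <-> exists w, sat phi (vcat w v).
Proof.
elim: k phi => [|k IH] phi /=.
  split=> [h|[w]]; first by exists (@vnil A); rewrite vcat0; exact: h.
  by rewrite vcat0 => h; exact: h.
rewrite IH; split=> [[w [a h]]|[w]]; first by exists (vcons a w); rewrite -vcat_cons.
rewrite (vcons_eta w) -vcat_cons => h; eexists; eexists; exact: h.
Qed.

(** * Back-and-forth relations *)

(** The relation A <=_l B of the asymmetric back-and-forth game: the opponent
extends the tuple on the right, the answer extends the one on the left, and the
sides are exchanged. *)
Fixpoint back_forth (l : nat) (A B : structure) n (v : 'I_n -> A) (w : 'I_n -> B) :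
    Prop :=
  match l with
  | 0 => forall i j, (v i = v j <-> w i = w j) /\ (prec (v i) (v j) <-> prec (w i) (w j))
  | l'.+1 => forall k (w' : 'I_k -> B), exists v' : 'I_k -> A,
      back_forth l' (vcat w' w) (vcat v' v)
  end.

Lemma back_forth0 l (A B : structure) n (v : 'I_n -> A) (w : 'I_n -> B) :
  back_forth l v w -> back_forth 0 v w.
Proof.
elim: l A B n v w => [//|l IH] A B n v w h.
have [v'] := h 0 (@vnil B); rewrite !vcat0 => /IH {}h i j.
by have [e p] := h i j; split; apply: iff_sym.
Qed.

Lemma back_forth_reindex l (A B : structure) m n (s : 'I_m -> 'I_n)
    (v : 'I_n -> A) (w : 'I_n -> B) :
  back_forth l v w -> back_forth l (v \o s) (w \o s).
Proof.
elim: l A B m n s v w => [|l IH] A B m n s v w h; first by move=> i j; apply: h.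
move=> k w'; have [v' h'] := h k w'; exists v'.
by rewrite -(vcat_lift_index s w') -(vcat_lift_index s v'); apply: IH.
Qed.

Lemma back_forth_refl l (A : structure) n (v : 'I_n -> A) : back_forth l v v.
Proof. by elim: l n v => [|l IH] n v //= k w; exists w. Qed.

Lemma back_forth_iso l (A A' B B' : structure) (f : A -> A') (h : B -> B') n
    (v : 'I_n -> A) (w : 'I_n -> B) :
  bijective f -> (forall x y, prec x y <-> prec (f x) (f y)) ->
  bijective h -> (forall x y, prec x y <-> prec (h x) (h y)) ->
  back_forth l v w -> back_forth l (f \o v) (h \o w).
Proof.
elim: l A A' B B' f h n v w => [|l IH] A A' B B' f h n v w bf fP bh hP vw.
  move=> i j; have [e p] := vw i j; split; last by rewrite /= -fP -hP.
  split=> [/(bij_inj bf)/e|/(bij_inj bh)/e] /= -> //.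
move=> k w'; have [h' _ h'K] := bh.
have [v' vw'] := vw k (h' \o w'); exists (f \o v').
have -> : vcat w' (h \o w) = h \o vcat (h' \o w') w.
  by rewrite vcat_comp; congr vcat; apply: funext => i /=; rewrite h'K.
by rewrite -vcat_comp; apply: IH.
Qed.

Lemma back_forth_qf (A B : structure) n (v : 'I_n -> A) (w : 'I_n -> B) phi :
  back_forth 0 v w -> quantifier_free phi -> (sat phi v <-> sat phi w).
Proof.
elim: phi v w => //= {n}n.
- by move=> i j v w h _; have [] := h i j.
- by move=> i j v w h _; have [] := h i j.
- by move=> p IHp v w h qf; rewrite (IHp v w).
- by move=> p IHp q IHq v w h [hp hq]; rewrite (IHp v w)// (IHq v w).
- by move=> p IHp q IHq v w h [hp hq]; rewrite (IHp v w)// (IHq v w).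
Qed.

(** Both halves are proved together since the exchange of sides turns the Pi
half at one level into the Sigma half at the level below. *)
Lemma back_forth_sat l (a : ord) (A B : structure) n (v : 'I_n -> A) (w : 'I_n -> B) phi :
  ole a (ofin l) -> back_forth l v w ->
  (Pi_in a phi -> sat phi v -> sat phi w) /\ (Sigma_in a phi -> sat phi w -> sat phi v).
Proof.
elim: l a A B n v w phi => [|l IH] a A B n v w phi al vw; split.
- case=> [{}phi _ qf|k b psi a0 ba _]; first by rewrite (back_forth_qf vw).
  by case: (ole_succ_zero (ole_trans a0 al)).
- case=> [{}phi _ qf|k b psi a0 ba _]; first by rewrite (back_forth_qf vw).
  by case: (ole_succ_zero (ole_trans a0 al)).
- case=> [{}phi _ qf|k b psi a0 ba hpsi /=]; first by rewrite (back_forth_qf (back_forth0 vw)).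
  move=> h i; apply/sat_all_block => w'.
  have [v' vw'] := vw _ w'.
  have [_ /(_ (hpsi i))] := IH _ _ _ _ _ _ (psi i) (olt_ofin (ba i) al) vw'.
  by apply; have /sat_all_block := h i; apply.
- case=> [{}phi _ qf|k b psi a0 ba hpsi /=]; first by rewrite (back_forth_qf (back_forth0 vw)).
  move=> [i /sat_ex_block[w' h]]; exists i; apply/sat_ex_block.
  have [v' vw'] := vw _ w'; exists v'.
  have [/(_ (hpsi i))] := IH _ _ _ _ _ _ (psi i) (olt_ofin (ba i) al) vw'.
  by move=> /(_ h).
Qed.

Section GraftTuples.
Variables (I : Type).

Lemma existT_inj (F : I -> structure) i : injective (existT F i).
Proof. by move=> x y e; apply: (@inj_inj _ F i); rewrite e. Qed.

Lemma graft_prec_tag (F : I -> structure) i j (x : F i) (y : F j) :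
  prec (Some (existT _ i x) : graft F) (Some (existT _ j y)) -> i = j.
Proof. by move=> /graft_above[z [e]]. Qed.

(** A tuple of a graft given by the branch of each entry ([None] for the root)
and, for every branch, a tuple of full length.  The entries of [V i] at
positions outside branch [i] are dummies; thanks to them all branches carry
tuples of the same length, and adding a block of points to the graft means
adding a block of that length in every branch. *)
Definition graft_tuple (F : I -> structure) n (t : 'I_n -> option I)
    (V : forall i, 'I_n -> F i) : 'I_n -> graft F :=
  fun p => if t p is Some i then Some (existT _ i (V i p)) else None.

(** The branches have to be inhabited to provide the dummy entries. *)
Lemma graft_tupleP (F : I -> structure) n (u : 'I_n -> graft F) :
  (forall i, inhabited (F i)) -> exists t V, u = graft_tuple t V.
Proof.
move=> hF; pose t p := omap (@tag _ F) (u p).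
have h i : exists V : 'I_n -> F i, forall p x, u p = Some (existT _ i x) -> V p = x.
  suff /choice[V hV] : forall p, exists y : F i, forall x, u p = Some (existT _ i x) -> y = x.
    by exists V.
  move=> p; have [[x e]|ne] := pselect (exists x, u p = Some (existT _ i x)).
    by exists x => y; rewrite e => -[] /existT_inj.
  by have [x0] := hF i; exists x0 => x e; case: ne; exists x.
have {h} [V hV] : exists V : forall i, 'I_n -> F i, forall i p x,
    u p = Some (existT _ i x) -> V i p = x.
  by exists (fun i => projT1 (cid (h i))) => i; exact: (projT2 (cid (h i))).
exists t, V; apply: funext => p.
rewrite /graft_tuple /t; case e: (u p) => [[i x]|//] /=.
by rewrite (hV _ _ _ e).
Qed.

Lemma graft_tuple_vcat (F : I -> structure) k n t t' V V' :
  vcat (graft_tuple t' V') (graft_tuple t V) =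
  graft_tuple (vcat t' t) (fun i => vcat (V' i) (V i)) :> ('I_(k + n) -> graft F).
Proof.
symmetry; apply: vcat_ext => p; rewrite /graft_tuple.
  by rewrite vcat_lshift; case: (t' p) => [i|//]; rewrite vcat_lshift.
by rewrite vcat_rshift; case: (t p) => [i|//]; rewrite vcat_rshift.
Qed.

(** The answer in the graft is composed of answers in the single branches. *)
Lemma back_forth_graft l (F F' : I -> structure) n (t : 'I_n -> option I)
    (V : forall i, 'I_n -> F i) (W : forall i, 'I_n -> F' i) :
  (forall i, inhabited (F i)) -> (forall i, inhabited (F' i)) ->
  (forall i, back_forth l (V i) (W i)) ->
  back_forth l (graft_tuple t V) (graft_tuple t W).
Proof.
elim: l F F' n t V W => [|l IH] F F' n t V W hF hF' VW.
  move=> p q; rewrite /graft_tuple.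
  case: (t p) (t q) => [i|] [j|] //.
  + have [e|ne] := pselect (i = j).
      case: _ / e; have [e p'] := VW i p q; split.
        by split=> [[/existT_inj/e ->]|[/existT_inj/e ->]].
      have pE (G : I -> structure) (x y : G i) :
        prec (Some (existT _ i x) : graft G) (Some (existT _ i y)) <-> prec x y
        := prec_inj x y.
      by rewrite !pE.
    split; first by split=> -[].
    by split=> /graft_prec_tag.
  + split; split=> // h; exfalso; exact: prec_None h.
  + split; split=> // _; exact: graft_root.
  + by split; split=> // /prec_None.
move=> k w'; have [t' [W' ->]] := graft_tupleP w' hF'.
have /(_ _)/cid hV' i := VW i k (W' i).
exists (graft_tuple t' (fun i => projT1 (hV' i))).
rewrite !graft_tuple_vcat; apply: IH => // i.
exact: (projT2 (hV' i)).
Qed.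

End GraftTuples.

(** * Embeddings of grafts and of the model trees *)

Lemma inj_surj_bij (A B : Type) (f : A -> B) :
  injective f -> (forall y, exists x, f x = y) -> bijective f.
Proof.
by move=> finj /choice[g gK]; exists g => // x; apply: finj; rewrite gK.
Qed.

Lemma card_le_tuple T k (P : set T) :
  `I_k #<= P <-> exists y : 'I_k -> T, injective y /\ forall i, P (y i).
Proof.
split=> [/card_leP[f]|[y [y_inj yP]]].
  exists (fun i : 'I_k => sval (f (exist _ (i : nat) (mem_set (ltn_ord i))))); split.
    move=> i j /val_inj/(@inj _ _ _ f _ _ (mem_set I) (mem_set I)) e.
    by apply: val_inj; exact: (congr1 sval e).
  by move=> i; apply: set_valP.
rewrite (card_le_eql card_II); apply: card_le_trans (subset_card_le (A := range y) _).
  by rewrite (card_le_eqr (inj_card_eq _))//; apply: in2W.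
by move=> _ [i _ <-].
Qed.

(** Turns the cardinality conditions of [tree_type] into indexings by the type
used in [tree_model]. *)
Lemma card_enum T N (P : set T) : P #= of_card N ->
  exists b : card_index N -> T, injective b /\ forall x, P x <-> exists s, b s = x.
Proof.
move=> /card_esym/card_bijP[f [g fK gK]]; exists (fun s => sval (f s)); split.
  by move=> s t /val_inj/(can_inj fK).
move=> x; split=> [Px|[s <-]]; last exact: set_valP.
by exists (g (exist _ x (mem_set Px))); rewrite gK.
Qed.

Lemma countable_infinite_nat T (P : set T) : countable P ->
  (forall p, exists y : 'I_p -> T, injective y /\ forall i, P (y i)) -> P #= [set: nat].
Proof.
move=> cP h; apply: eq_card_nat => // -[n e].
by have /card_le_tuple := h n.+1; rewrite (card_le_eqr e) card_le_II ltnn.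
Qed.

Section GraftMap.
Variables (I I' : Type) (F : I -> structure) (F' : I' -> structure).
Variables (G : I -> I') (e : forall i, F i -> F' (G i)).

Definition graft_map (x : graft F) : graft F' :=
  if x is Some s then Some (existT F' (G (tag s)) (e (tagged s))) else None.

Hypothesis G_inj : injective G.
Hypothesis e_inj : forall i, injective (@e i).
Hypothesis eP : forall i (x y : F i), prec x y <-> prec (e x) (e y).

Lemma graft_map_inj : injective graft_map.
Proof.
move=> [[i x]|] [[j y]|] //= [/G_inj ij]; case: _ / ij y => y.
by move=> h; rewrite (e_inj (existT_inj h)).
Qed.

Lemma graft_map_prec (x y : graft F) : prec x y <-> prec (graft_map x) (graft_map y).
Proof.
case: x y => [[i x]|] [[j y]|] /=.
- have [ij|ne] := pselect (i = j).
    case: _ / ij y => y.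
    exact: iff_trans (prec_inj x y) (iff_trans (eP x y) (iff_sym (prec_inj _ _))).
  by split=> h; case: ne; [exact: graft_prec_tag h|exact: G_inj (graft_prec_tag h)].
- by split=> /prec_None.
- by split=> _; apply: graft_root.
- by split=> /prec_None.
Qed.

Lemma graft_map_bij : bijective G -> (forall i, bijective (@e i)) -> bijective graft_map.
Proof.
move=> [H HK GK] be; apply: inj_surj_bij graft_map_inj _ => -[[i' x]|]; last by exists None.
rewrite -(GK i') in x *; have [f fK eK] := be (H i').
by exists (Some (existT _ (H i') (f x))); rewrite /= eK.
Qed.

End GraftMap.

Definition omega_index (i : nat) : card_index omega := exist _ i (mem_set I).

Definition fin_index k (i : 'I_k) : card_index (Some k) := exist _ (i : nat) (mem_set (ltn_ord i)).

Lemma omega_indexP (a : card_index omega) : exists i, a = omega_index i.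
Proof. by exists (val a); apply: val_inj. Qed.

(** List the prescribed values first and continue with indices larger than all
of them. *)
Lemma cover_injection c k (h : 'I_c -> card_index omega) : c <= k ->
  exists g : card_index (Some k) -> card_index omega,
    injective g /\ forall p, exists q, g q = h p.
Proof.
move=> ck; pose s := undup [seq val (h p) | p <- enum 'I_c].
have sk : size s <= k.
  by apply: leq_trans (size_undup _) _; rewrite size_map size_enum_ord.
pose g i := if i < size s then nth 0 s i else (\max_(x <- s) x).+1 + i.
have s_max x : x \in s -> x < (\max_(x <- s) x).+1.
  by move=> xs; rewrite ltnS; exact: leq_bigmax_seq.
have g_inj : injective g.
  move=> i j; rewrite /g; case: ltnP => hi; case: ltnP => hj.
  - by move/eqP; rewrite nth_uniq ?undup_uniq// => /eqP.
  - by move=> e; have := s_max _ (mem_nth 0 hi); rewrite e ltnNge leq_addr.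
  - by move=> e; have := s_max _ (mem_nth 0 hj); rewrite -e ltnNge leq_addr.
  - by move/addnI.
exists (fun a => omega_index (g (val a))); split.
  by move=> a b /(congr1 val) /g_inj /val_inj.
move=> p; have ps : val (h p) \in s.
  by rewrite mem_undup; apply: map_f; rewrite mem_enum.
have ip : index (val (h p)) s < k by apply: leq_trans sk; rewrite index_mem.
exists (fin_index (Ordinal ip)); apply: val_inj => /=.
by rewrite /g index_mem ps nth_index.
Qed.

Section Embedding.
Variables (k : nat) (g : card_index (Some k) -> card_index omega).

(** Finite labels are kept; [g] selects which branches of type [omega] belong to
the image. *)
Definition child_map (s : child_index (Some k)) : child_index omega :=
  match s with inl a => inl (g a) | inr p => inr p end.

(** On every branch this is the identity, typed by a case analysis because
[child_type (child_map s)] reduces to [child_type s] only for [s] of a known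
form. *)
Definition model_map n : tree_model n.+1 (Some k) -> tree_model n.+1 omega :=
  match n with
  | 0 => @graft_map _ _ (fun=> Defs.point) (fun=> Defs.point) g (fun _ => id)
  | n'.+1 =>
    @graft_map _ _ (fun s => tree_model n'.+1 (child_type s))
      (fun s => tree_model n'.+1 (child_type s)) child_map
      (fun s => match s return tree_model n'.+1 (child_type s) ->
                               tree_model n'.+1 (child_type (child_map s))
                with inl _ => id | inr _ => id end)
  end.

Hypothesis g_inj : injective g.

Lemma child_map_inj : injective child_map.
Proof. by move=> [a|p] [b|q] //= [] => [/g_inj|] ->. Qed.

Lemma model_map_inj n : injective (@model_map n).
Proof.
case: n => [|n]; first by apply: graft_map_inj => // i x y.
by apply: graft_map_inj child_map_inj _; case=> s x y e; exact: e.
Qed.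

Lemma model_map_prec n x y : prec x y <-> prec (@model_map n x) (@model_map n y).
Proof.
case: n x y => [|n] x y; first exact: graft_map_prec.
by apply: (graft_map_prec child_map_inj); case=> s u v; exact: iff_refl.
Qed.

(** The branches of type [omega] outside the image of [g] can be added to the
branches with label [j]: the result is again countably infinite, so it is
matched with the branches of label [j] alone.  All other branches correspond
along [child_map]. *)
Lemma absorbing_bijection j : exists b : child_index omega -> child_index (Some k),
  [/\ bijective b,
      forall i, (forall q, i <> inr (j, q)) -> b (child_map i) = i &
      forall s, (exists i, s = child_map i /\ forall q, i <> inr (j, q)) \/
        child_type s \in [:: omega; Some j] /\ exists q, b s = inr (j, q)].
Proof.
pose free (i : child_index (Some k)) := forall q, i <> inr (j, q).
pose Z : set (child_index omega) := [set s | forall i, free i -> child_map i <> s].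
have : Z #= [set: nat].
  apply: eq_card_nat; first exact: sub_countable (card_leT _) (child_index_countable _).
  apply/infiniteP; apply: card_le_trans (subset_card_le (A := range (fun q => inr (j, q))) _).
    by rewrite (card_le_eqr (inj_card_eq _))//; apply: in2W => p q [].
  by move=> _ [q _ <-] [a|p] fi //= [e]; case: (fi q); rewrite e.
move=> /card_set_bijP[f [_ f_inj f_surj]].
have /choice[b bP] : forall s, exists i,
    (free i /\ child_map i = s) \/ Z s /\ i = inr (j, f s).
  move=> s; have [[i h]|h] := pselect (exists i, free i /\ child_map i = s).
    by exists i; left.
  by exists (inr (j, f s)); right; split=> // i fi e; apply: h; exists i.
have bK i : free i -> b (child_map i) = i.
  by move=> fi; case: (bP (child_map i)) => [[_ /child_map_inj]|[/(_ i fi)]].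
exists b; split=> //.
- apply: inj_surj_bij => [s t|i].
    case: (bP s) => [[fs es]|[Zs es]]; case: (bP t) => [[ft et]|[Zt et]] bst.
    + by rewrite -es -et bst.
    + by case: (fs (f t)); rewrite bst.
    + by case: (ft (f s)); rewrite -bst.
    + by move: bst; rewrite es et => -[]; apply: f_inj; rewrite inE.
  have [fi|] := pselect (free i); first by exists (child_map i); apply: bK.
  move=> /existsNP[q /contrapT ->]; have [s Zs fs] := f_surj q I.
  by exists s; case: (bP s) => [[fi e]|[_ ->]]; [case: (Zs _ fi)|rewrite fs].
- move=> s; case: (bP s) => [[fi e]|[Zs e]]; first by left; exists (b s).
  right; split; last by exists (f s).
  case: s Zs {e} => [a|[l q]] Zs; first by rewrite /= !inE eqxx.
  suff -> : l = j by rewrite /= !inE eqxx orbT.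
  by apply: contrapT => lj; apply: (Zs (inr (l, q))) => // q' [].
Qed.

End Embedding.

(** * A tree with finitely many branches of type omega *)

Local Notation branch n N :=
  (fun s : child_index N => carrier (tree_model n.+1 (child_type s))).

Lemma tree_model_inhabited n N : inhabited (tree_model n N).
Proof. case: n => [|[|n]]; [exact: (inhabits tt)|exact: (inhabits None)..]. Qed.

Lemma model_map_cover n c k (v : 'I_c -> tree_model n.+1 omega) : c <= k ->
  exists2 g : card_index (Some k) -> card_index omega, injective g &
    exists w, v = @model_map k g n \o w.
Proof.
move=> ck.
have toF (g : card_index (Some k) -> card_index omega) :
    (forall p, exists y, @model_map k g n y = v p) ->
    exists w, v = @model_map k g n \o w.
  by move=> /choice[w wP]; exists w; apply: funext => p /=; rewrite wP.
case: n v toF => [|n] v toF.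
  have [g [g_inj gP]] := cover_injection
    (fun p => if v p is Some s then tag s else omega_index 0) ck.
  exists g => //; apply: toF => p; have [q] := gP p.
  case: (v p) => [[a []]|] /= e; last by exists None.
  by exists (Some (existT _ q tt)); rewrite /= e.
have [g [g_inj gP]] := cover_injection (fun p =>
  if v p is Some (existT (inl a) _) then a else omega_index 0) ck.
exists g => //; apply: toF => p; have [q] := gP p.
case: (v p) => [[[a|i] x]|] /= e; last by exists None.
  rewrite -e in x *.
  by exists (Some (existT (branch n (Some k)) (inl q) x)).
by exists (Some (existT (branch n (Some k)) (inr i) x)).
Qed.

(** The opponent's points of the smaller tree are copied along the embedding. *)
Lemma back_forth_embed n k (g : card_index (Some k) -> card_index omega) l :
  (forall c (w : 'I_c -> tree_model n.+1 (Some k)), back_forth l w (@model_map k g n \o w)) ->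
  forall c (w : 'I_c -> tree_model n.+1 (Some k)), back_forth l.+1 (@model_map k g n \o w) w.
Proof.
move=> h c w k' w'; exists (@model_map k g n \o w').
by rewrite -vcat_comp; apply: h.
Qed.

(** The opponent's points of the larger tree may lie in branches of type [omega]
outside the image.  They are answered in branches with a label [j] that exceeds
both the length of the extended tuple, so that [IH] applies to these branches,
and all the labels met by [w], so that the absorbing bijection does not move the
branches containing [w]. *)
Lemma back_forth_absorb n k (g : card_index (Some k) -> card_index omega) l :
  injective g ->
  (forall c j (v : 'I_c -> tree_model n.+1 omega), c <= j ->
    exists w : 'I_c -> tree_model n.+1 (Some j), back_forth l v w) ->
  forall c (w : 'I_c -> tree_model n.+2 (Some k)),
    back_forth l.+1 w (@model_map k g n.+1 \o w).
Proof.
move=> g_inj IH c w c' w'.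
have hF N (s : child_index N) := tree_model_inhabited n.+1 (child_type s).
have [t [V uE]] := graft_tupleP (vcat w' (@model_map k g n.+1 \o w)) (@hF _).
pose label p := if w p is Some (existT (inr (l, _)) _) then l else 0.
pose j := (c' + c + \max_p label p).+1.
have w_free p i x : w p = Some (existT _ i x) -> forall q, i <> inr (j, q).
  move=> e q eq; have : label p <= \max_p label p by apply: leq_bigmax.
  by rewrite /label e eq leqNgt /j ltnS leq_addl.
have [b [b_bij bK bP]] := absorbing_bijection g_inj j.
(* The part of [V] that comes from [w], seen in the branch of each entry. *)
have VE p i x : w p = Some (existT _ i x) ->
    t (rshift c' p) = Some (child_map g i) /\
    existT (branch n omega) (child_map g i)
      (V (child_map g i) (rshift c' p)) =
    existT (branch n omega) (child_map g i)
     (match i return tree_model n.+1 (child_type i) ->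
                   tree_model n.+1 (child_type (child_map g i))
                with inl _ => id | inr _ => id end x).
  move=> e; have := congr1 (@^~ (rshift c' p)) uE.
  rewrite /= vcat_rshift /= e /graft_tuple /=.
  by case: (t _) => // s [<-]; split.
have /(_ _)/cid hW : forall s, exists W : 'I_(c' + c) -> tree_model n.+1 (child_type (b s)),
    back_forth l (V s) W /\
    forall p i x, w p = Some (existT _ i x) -> child_map g i = s ->
      Some (existT (branch n (Some k)) (b s) (W (rshift c' p))) = w p.
  move=> s; have [[i [-> fi]]|] := bP s.
    rewrite bK//; case: i fi => [a|q] fi.
      exists (V (inl (g a))); split; first exact: back_forth_refl.
      move=> p i' x e /(child_map_inj g_inj) ii'; rewrite {}ii' in x e *; rewrite e.
      have [_ h] := VE _ _ _ e.
      by have /= -> := @existT_inj _ (fun s => tree_model n.+1 (child_type s)) _ _ _ h.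
    exists (V (inr q)); split; first exact: back_forth_refl.
    move=> p i' x e /(child_map_inj g_inj) ii'; rewrite {}ii' in x e *; rewrite e.
    have [_ h] := VE _ _ _ e.
    by have /= -> := @existT_inj _ (fun s => tree_model n.+1 (child_type s)) _ _ _ h.
  rewrite !inE => -[hs [q bs]].
  have s_new p i x : w p = Some (existT _ i x) -> child_map g i <> s.
    move=> e si; have := w_free _ _ _ e; rewrite -(bK i); last exact: (w_free _ _ _ e).
    by rewrite si bs => /(_ q).
  rewrite bs; suff [W VW] : exists W : 'I_(c' + c) -> tree_model n.+1 (Some j),
      back_forth l (V s) W.
    by exists W; split=> // p i x /s_new.
  move: (V s); case/orP: hs => /eqP -> v; last by exists v; apply: back_forth_refl.
  by apply: IH; rewrite /j leqW// leq_addr.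
(* The answers are now available branch by branch; [f] carries the graft of the
   branches reindexed by [b] back to the smaller tree. *)
pose W s := projT1 (hW s).
have VW s : back_forth l (V s) (W s) := (projT2 (hW s)).1.
have WE s p i x : w p = Some (existT _ i x) -> child_map g i = s ->
  Some (existT (branch n (Some k)) (b s) (W s (rshift c' p))) = w p := (projT2 (hW s)).2 p i x.
pose f := @graft_map _ _ (fun s => tree_model n.+1 (child_type (b s)))
   (fun s => tree_model n.+1 (child_type s)) b (fun _ => id).
have f_bij : bijective f by apply: graft_map_bij => // [|s x y //|s]; [exact: bij_inj|exists id].
have fP : forall x y, prec x y <-> prec (f x) (f y) by apply: graft_map_prec => //; exact: bij_inj.
exists (fun p => f (graft_tuple t W (lshift c p))); rewrite uE.
have -> : vcat (fun p => f (graft_tuple t W (lshift c p))) w = f \o graft_tuple t W.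
  symmetry; apply: vcat_ext => //= p; rewrite /graft_tuple.
  case e: (w p) => [[i x]|]; first by have [-> _] := VE _ _ _ e; rewrite /= (WE _ _ _ _ e)// e.
  have := congr1 (@^~ (rshift c' p)) uE.
  by rewrite /= vcat_rshift /= e /graft_tuple; case: (t _).
rewrite -[graft_tuple t V]/(id \o _); apply: back_forth_iso => //; first by exists id.
apply: back_forth_graft VW => s.
  exact: (tree_model_inhabited n.+1 (child_type s)).
exact: (tree_model_inhabited n.+1 (child_type (b s))).
Qed.

(** One more level of the tree costs two rounds: [back_forth_absorb] followed by
[back_forth_embed].  At the bottom, the embedding of a star in a larger one
preserves atomic formulas. *)
Theorem back_forth_omega_fin n c k (v : 'I_c -> tree_model n.+1 omega) : c <= k ->
  exists w : 'I_c -> tree_model n.+1 (Some k), back_forth (2 * n).+1 v w.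
Proof.
elim: n c k v => [|n IH] c k v ck; have [g g_inj [w ->]] := model_map_cover v ck;
  exists w; apply: back_forth_embed => // {v w ck}c w.
  rewrite muln0 => i j; split; last exact: model_map_prec.
  by split=> [/= ->//|/(model_map_inj g_inj)].
by rewrite mulnS; apply: back_forth_absorb.
Qed.

(** * Lower bound *)

Lemma vnil_unique A (v : 'I_0 -> A) : v = @vnil A.
Proof. by apply: funext => -[]. Qed.

(** A true Sigma formula is implied by a Pi formula, one level below, of some
tuple [u]. *)
Lemma Sigma_in_witness l a (M : structure) n (v : 'I_n -> M) phi :
  Sigma_in a phi -> ole a (ofin l.+1) -> sat phi v ->
  exists c (u : 'I_c -> M), forall (B : structure) (w : 'I_n -> B) (u' : 'I_c -> B),
    back_forth l (vcat u v) (vcat u' w) -> sat phi w.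
Proof.
case=> [{}phi _ qf|k b psi a0 ba hpsi] al /=.
  move=> h; exists 0, (@vnil M) => B w u'; rewrite !vcat0 => /back_forth0 vw.
  by rewrite -(back_forth_qf vw).
move=> [i /sat_ex_block[u h]]; exists (k i), u => B w u' vw.
exists i; apply/sat_ex_block; exists u'.
exact: (back_forth_sat (psi i) (olt_ofin (ba i) al) vw).1.
Qed.

Lemma tree_model_countable n N : countable [set: tree_model n.+1 N].
Proof.
suff /tree_countable : is_tree (tree_model n.+1 N) by [].
by have [+ _] := tree_model_type n N; case: n => [|n] [].
Qed.

Lemma omega_fin_not_isomorphic n k :
  ~ isomorphic (tree_model n.+1 omega) (tree_model n.+1 (Some k)).
Proof.
move=> i; have [t _] := tree_model_type n omega; have [t' _] := tree_model_type n (Some k).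
by have := tree_type_inj (tree_type_iso i t) t'.
Qed.

Lemma scott_sentence_separates m phi : scott_sentence (tree_model m.+1 omega) phi ->
  forall c (v : 'I_c -> tree_model m.+1 omega),
  ~ forall (B : structure) (w : 'I_c -> B), back_forth (2 * m).+1 v w -> models B phi.
Proof.
move=> h c v hv; have [w /hv] := back_forth_omega_fin v (leqnn c).
move/h => /(_ (tree_model_inhabited _ _) (tree_model_countable _ _)).
exact: omega_fin_not_isomorphic.
Qed.

(** By totality, [ole_ofin_total], a complexity that is not at least Pi_(2m+2)
is at most Sigma_(2m+2), Pi_(2m+1) or d-Sigma_(2m+1).  Truth of a sentence of
such a complexity passes from [m+1 : omega] with a suitable tuple to every
structure above it in the relation of level 2m+1. *)
Lemma SSC_lower_bound m d : has_scott_sentence (tree_model m.+1 omega) d ->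
  complexity_le (CPi (ofin (2 * m + 2))) d.
Proof.
move=> [phi phi_d phi_A]; have no := scott_sentence_separates phi_A.
have phi_M : models (tree_model m.+1 omega) phi.
  apply/phi_A; [exact: tree_model_inhabited|exact: tree_model_countable|].
  by exists id; split; [exists id|].
rewrite addn2; case: d phi_d => a /=.
- case: (ole_ofin_total (2 * m).+2 a) => // al phi_d; exfalso.
  have [c [u hu]] := Sigma_in_witness phi_d al phi_M.
  apply: (no _ (vcat u (@vnil _))) => B w; rewrite (vcat_split w) => /hu.
  by rewrite (vnil_unique (fun=> _)).
- case: (ole_ofin_total (2 * m).+1 a) => // al phi_d; exfalso.
  apply: (no _ (@vnil _)) => B w vw.
  rewrite /models -(vnil_unique w).
  exact: (back_forth_sat phi al vw).1.
case: (ole_ofin_total (2 * m).+1 a) => // al [p p_S [q q_P e]]; exfalso; subst phi.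
have [p_M q_M] := phi_M.
have [c [u hu]] := Sigma_in_witness p_S (ole_trans al (ole_ofin (leqnSn _))) p_M.
apply: (no _ (vcat u (@vnil _))) => B w vw; rewrite (vcat_split w) in vw.
split; first by rewrite -(vnil_unique (fun i => w (rshift c i))); exact: hu vw.
have := (back_forth_sat q al (back_forth_reindex (@rshift c 0) vw)).1 q_P.
by rewrite (vnil_unique (_ \o _)) (vnil_unique (vcat _ _ \o _)); apply.
Qed.

(** * Tree types determine countable trees *)

Lemma isomorphic_trans A B C : isomorphic A B -> isomorphic B C -> isomorphic A C.
Proof.
move=> [f [bf fP]] [g [bg gP]]; exists (g \o f); split; first exact: bij_comp.
by move=> x y; rewrite fP gP.
Qed.

(** Otherwise [R] descends for ever in [D], which gives more distinct elements
than [D] has. *)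
Lemma finite_minimal T (R : T -> T -> Prop) (D : set T) x :
  (forall y z w, R y z -> R z w -> R y w) -> (forall y, ~ R y y) ->
  finite_set D -> D x -> exists2 y, D y & forall z, D z -> ~ R z y.
Proof.
move=> Rtr Rirr [n Dn] Dx; apply: contrapT => h.
have /choice[f fP] : forall y, exists z, D y -> D z /\ R z y.
  move=> y; have [Dy|] := pselect (D y); last by exists y.
  apply: contrapT => h'; apply: h; exists y => // z Dz zy.
  by apply: h'; exists z.
pose s i := iter i f x.
have Ds i : D (s i) by elim: i => //= i /fP[].
have sR i j : i < j -> R (s j) (s i).
  elim: j => // j IH; rewrite ltnS leq_eqVlt => /orP[/eqP ->|/IH h']; first exact: (fP _ (Ds j)).2.
  exact: Rtr (fP _ (Ds j)).2 h'.
have : `I_n.+1 #<= D.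
  apply/card_le_tuple; exists (fun i => s i); split=> // i j e; apply: val_inj => /=.
  by case: (ltngtP i j) => // /sR; rewrite e => /Rirr.
by rewrite (card_le_eqr Dn) card_le_II ltnn.
Qed.

Section Tree.
Variable T : structure.
Implicit Types x y z : T.

(** The type of the subtree above a node, expressed inside the ambient tree to
avoid subtrees of subtrees; [node_type n] corresponds to [tree_type n.+1]. *)
Fixpoint node_type (n : nat) (N : omega1) (x : T) : Prop :=
  match n with
  | 0 => [set y | prec x y] #= of_card N /\ forall y z, prec x y -> ~ prec y z
  | n'.+1 =>
    [/\ [set y | immediate_succ x y /\ node_type n' omega y] #= of_card N,
        (forall k : nat,
          [set y | immediate_succ x y /\ node_type n' (Some k) y] #= [set: nat]) &
        forall y, immediate_succ x y -> exists M, node_type n' M y]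
  end.

Lemma node_type_inj n M N x : node_type n M x -> node_type n N x -> M = N.
Proof.
case: n => [|n] /=.
  by move=> [h _] [h' _]; exact: of_card_inj (card_eq_trans (card_esym h) h').
by move=> [h _ _] [h' _ _]; exact: of_card_inj (card_eq_trans (card_esym h) h').
Qed.

Hypothesis tT : is_tree T.

(** A minimal element of the finite interval between [x] and [z]. *)
Lemma prec_child x z : prec x z -> exists2 y, immediate_succ x y & y = z \/ prec y z.
Proof.
move=> xz; pose D : set T := [set y | prec x y /\ (y = z \/ prec y z)].
have fD : finite_set D.
  apply: (@sub_finite_set _ _ ([set z] `|` [set y | prec y z])).
    by move=> y [_ []]; [left|right].
  by rewrite finite_setU; split; [exact: finite_set1|exact: tree_finite].
have [y [xy yz] ymin] := finite_minimal (tree_trans tT) (tree_irr tT) fD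
  (conj xz (or_introl erefl)).
exists y => //; split=> // -[w [xw wy]]; apply: (ymin w) => //; split=> //; right.
by case: yz => [<-//|]; apply: (tree_trans tT) wy.
Qed.

(** The predecessors of [z] form a chain, so a node has at most one child below
or at [z]. *)
Lemma children_antichain x y y' z : immediate_succ x y -> immediate_succ x y' ->
  y = z \/ prec y z -> y' = z \/ prec y' z -> y = y'.
Proof.
move=> [xy ny] [xy' ny'] yz y'z.
have [//|[yy'|y'y]] : y = y' \/ (prec y y' \/ prec y' y).
  case: yz y'z => [->|yz] [->|y'z]; [by left|by right;right|by right;left|].
  by case: (tree_linear tT yz y'z) => [|[]]; [by right;left|by left|by right;right].
- by case: ny'; exists y.
- by case: ny; exists y'.
Qed.

Lemma level1_child r x : is_root r -> level x 1 <-> immediate_succ r x.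
Proof.
move=> rr; split=> [lx|[rx nx]].
  have rx : prec r x.
    case: (rr x) => // e; move: lx; rewrite e /level.
    have -> : [set y | prec y r] = set0.
      apply/seteqP; split=> // y yr; case: (rr y) => [yE|ry].
        by move: yr; rewrite yE => /(tree_irr tT).
      exact: (tree_irr tT) (tree_trans tT yr ry).
    by rewrite card_eq_sym card_eq0 => /eqP/seteqP[/(_ 0 erefl)].
  split=> // -[z [rz zx]].
  have : `I_2 #<= `I_1.
    rewrite -(card_le_eqr lx); apply/card_le_tuple.
    exists (fun i : 'I_2 => if val i is 0 then r else z); split; last first.
      by move=> [[|i] hi].
    have rz' : r <> z by move=> e; move: rz; rewrite e => /(tree_irr tT).
    by move=> [[|[|i]] hi] [[|[|j]] hj] //= e; apply: val_inj => //=; case: rz'.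
  by rewrite card_le_II.
rewrite /level; have -> : [set y | prec y x] = [set r]; last exact: card_set1.
apply/seteqP; split=> [y yx|y -> //]; case: (rr y) => // ry; by case: nx; exists y.
Qed.

Lemma subtree_succ x (u v : subtree x) :
  immediate_succ u v <-> immediate_succ (sval u) (sval v).
Proof.
have up z : prec (sval u) z -> z = x \/ prec x z.
  by move=> uz; right; case: (svalP u) => [<-//|xu]; apply: (tree_trans tT) uz.
split=> -[uv nz]; split=> // -[z [uz zv]]; apply: nz; last by exists (sval z).
by exists (exist _ z (up z uz)).
Qed.

Lemma subtree_card x (P : set (subtree x)) (Q : set T) :
  (forall u, P u <-> Q (sval u)) -> (forall y, Q y -> y = x \/ prec x y) -> P #= Q.
Proof.
move=> PQ Qx; have -> : Q = (fun u : subtree x => sval u) @` P.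
  apply/seteqP; split=> [y Qy|_ [u /PQ Qu <-] //].
  by exists (exist _ y (Qx y Qy)) => //; apply/PQ.
apply: card_esym; apply: inj_card_eq; apply: in2W => -[u hu] [v hv] /= e.
exact: eq_exist.
Qed.

End Tree.

Lemma subtree_node_type (T : structure) (tT : is_tree T) (x : T) n N (u : subtree x) :
  node_type n N u <-> node_type n N (sval u).
Proof.
have up (v : subtree x) z : prec (sval v) z -> z = x \/ prec x z.
  by move=> vz; right; case: (svalP v) => [<-//|xv]; apply: (tree_trans tT) vz.
elim: n N u => [|n IH] N u /=.
  have e : [set v | prec u v] #= [set y | prec (sval u) y].
    by apply: subtree_card => // y; apply: up.
  split=> -[h nz].
    split=> [|y z uy yz]; first by rewrite -(card_eql e).
    have zx := up u z (tree_trans tT uy yz).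
    exact: (nz (exist _ y (up u y uy)) (exist _ z zx)).
  by split=> [|y z uy yz]; [rewrite (card_eql e)|exact: nz uy yz].
have e M : [set v | immediate_succ u v /\ node_type n M v] #=
    [set y | immediate_succ (sval u) y /\ node_type n M y].
  apply: subtree_card => [v|y [[uy _] _]]; last exact: up uy.
  by split=> -[/(subtree_succ tT) h1 /IH h2].
split=> -[h1 h2 h3].
  split=> [|k|y uy]; [by rewrite -(card_eql (e _))|by rewrite -(card_eql (e _))|].
  have [M /IH h] := h3 (exist _ y (up u y uy.1))
    (proj2 (subtree_succ tT u (exist _ y (up u y uy.1))) uy).
  by exists M.
split=> [|k|y /(subtree_succ tT) uy]; [by rewrite (card_eql (e _))|by rewrite (card_eql (e _))|].
by have [M /IH h] := h3 _ uy; exists M.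
Qed.

Lemma tree_type_is_tree n N T : tree_type n N T -> is_tree T.
Proof. by case: n => [//|[|n]] []. Qed.

(** For [n = 0], rank at most one forbids grandchildren of the root. *)
Lemma node_type_root n N (T : structure) (r : T) :
  is_root r -> tree_type n.+1 N T -> node_type n N r.
Proof.
elim: n N T r => [|n IH] N T r rr tt; have tT := tree_type_is_tree tt.
  case: tt => _ [a [r1 [rr1 ra]] a1] [r2 rr2 h].
  have root_eq s : is_root s -> s = r.
    move=> rs; case: (rr s) => // rs'; case: (rs r) => [//|sr].
    by case: (tree_irr tT (tree_trans tT rs' sr)).
  rewrite (root_eq _ rr1) in ra; rewrite (root_eq _ rr2) in h.
  case: ra => rk hrk ha.
  have nochild y z : immediate_succ r y -> ~ immediate_succ y z.
    move=> ry yz; have := hrk _ ry; case=> rk' _ hb.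
    have b0 : ole (rk y) Ozero.
      by apply: ole_succ_inv; apply: ole_trans a1; apply: (proj1 (ha a) (ole_refl a)).
    exact: ole_succ_zero (proj1 (hb _) b0 z yz).
  have noabove y z : immediate_succ r y -> ~ prec y z.
    by move=> ry /(prec_child tT)[w yw _]; exact: nochild yw.
  have succE y : prec r y <-> immediate_succ r y.
    split=> [/(prec_child tT)[w rw [<-//|wy]]|[]//].
    by case: (noabove w y).
  split; last by move=> y z /succE; apply: noabove.
  apply: card_eq_trans h; rewrite (_ : [set y | _] = [set x | immediate_succ r x])//.
  by apply/seteqP; split=> y /succE.
case: tt => _ _ h1 h2 h3.
have E M (y : T) : tree_type n.+1 M (subtree y) -> node_type n M y.
  move=> ty; have rt : @is_root (subtree y) (exist _ y (or_introl erefl)).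
    move=> [z [zy|yz]]; [left; exact: eq_exist|by right].
  exact: (proj1 (subtree_node_type tT _ _ (exist _ y (or_introl erefl)))
    (IH _ _ _ rt ty)).
have E' M (y : T) : immediate_succ r y -> tree_type n.+1 M (subtree y) <-> node_type n M y.
  move=> /(level1_child tT _ rr) ly; split; first exact: E.
  by move=> ny; have [M' t'] := h3 _ ly; rewrite (node_type_inj ny (E _ _ t')).
have eqset M : [set x : T | level x 1 /\ tree_type n.+1 M (subtree x)] =
  [set y | immediate_succ r y /\ node_type n M y].
  apply/seteqP; split=> y [h h']; split.
  - by apply/(level1_child tT y rr).
  - exact: E.
  - by apply/(level1_child tT y rr).
  - by apply/E'.
split=> [|k|y ry]; [rewrite -eqset; exact: h1|rewrite -eqset; exact: (h2 k)|].
by have [M /E] := h3 y (proj2 (level1_child tT _ rr) ry); exists M.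
Qed.

(** Every element above [x] lies above or at exactly one child of [x], by
[prec_child] and [children_antichain]. *)
Lemma subtree_graft (T : structure) (tT : is_tree T) (x : T) (I : Type)
    (F : I -> structure) (b : I -> T) :
  injective b -> (forall y, immediate_succ x y <-> exists s, b s = y) ->
  (forall s, isomorphic (F s) (subtree (b s))) -> isomorphic (graft F) (subtree x).
Proof.
move=> b_inj b_child /(_ _)/cid hf.
pose f s := projT1 (hf s).
have f_bij s : bijective (f s) := (projT2 (hf s)).1.
have fP s y z : prec y z <-> prec (f s y) (f s z) := (projT2 (hf s)).2 y z.
have bx s : immediate_succ x (b s) by apply/b_child; exists s.
have above s (y : F s) : prec x (sval (f s y)).
  case: (svalP (f s y)) => [->|]; first exact: (bx s).1.
  exact: (tree_trans tT) (bx s).1.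
have same_branch s t (y : F s) (z : F t) :
    sval (f s y) = sval (f t z) \/ prec (sval (f s y)) (sval (f t z)) -> s = t.
  move=> yz; apply: b_inj.
  apply: (children_antichain tT (z := sval (f t z)) (bx s) (bx t)).
    case: (svalP (f s y)) yz => [->|sy] yz; case: yz => [<-|yz]; [by left|by right|by right|].
    by right; exact: (tree_trans tT) sy yz.
  by case: (svalP (f t z)) => h; [left; rewrite h|right].
pose h (p : graft F) : subtree x :=
  if p is Some s then exist (fun y => y = x \/ prec x y) _ (or_intror (above _ (tagged s)))
  else exist _ x (or_introl erefl).
have x_irr := tree_irr tT (x := x).
exists h; split.
  apply: inj_surj_bij => [p q /(congr1 sval)|[z zx]].
    case: p q => [[s y]|] [[t z]|] //=.
    - move=> e; have st := same_branch _ _ _ _ (or_introl e).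
      case: _ / st z e => z e; congr (Some (existT _ _ _)).
      apply: (bij_inj (f_bij s)); move: e; case: (f s y) (f s z) => [u hu] [v hv] /= e.
      exact: eq_exist.
    - by move=> e; have := above s y; rewrite e => /x_irr.
    - by move=> e; have := above t z; rewrite -e => /x_irr.
  case: (zx) => [e|xz]; first by exists None; apply: eq_exist; rewrite e.
  have [y /b_child[s <-] yz] := prec_child tT xz.
  have hz : z = b s \/ prec (b s) z by case: yz; [left|right].
  have [g _ gK] := f_bij s; exists (Some (existT _ s (g (exist _ z hz)))).
  by apply: eq_exist => /=; rewrite gK.
case=> [[s y]|] [[t z]|] /=.
- split=> [yz|yz].
    have st := graft_prec_tag yz; case: _ / st z yz => z /(prec_inj y z).
    by rewrite fP.
  have st := same_branch _ _ _ _ (or_intror yz); case: _ / st z yz => z yz.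
  by apply/(prec_inj y z)/fP.
- split=> [/prec_None//|yx]; exfalso.
  exact: x_irr (tree_trans tT (above s y) yx).
- by split=> _; [exact: above|exact: graft_root].
- by split=> [/prec_None//|/x_irr].
Qed.

(** Enumerate the children of each type by the index type of the model, then
glue the isomorphisms of the branches.  Children enumerated under different
labels differ by [node_type_inj]. *)
Lemma node_type_subtree n N (T : structure) (x : T) : is_tree T -> node_type n N x ->
  isomorphic (tree_model n.+1 N) (subtree x).
Proof.
move=> tT; elim: n N x => [|n IH] N x.
  move=> [/card_enum[b [b_inj bP]] nz].
  apply: (subtree_graft tT b_inj) => [y|s].
    rewrite -bP; split=> [[]//|xy]; split=> // -[z [xz zy]]; exact: nz xz zy.
  have xb : prec x (b s) by apply/bP; exists s.
  have one (z : subtree (b s)) : z = exist _ (b s) (or_introl erefl).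
    by case: z => z hz; apply: eq_exist; case: hz => // /(nz _ _ xb).
  exists (fun _ => exist _ (b s) (or_introl erefl)); split.
    by exists (fun _ => tt) => [[]//|z]; rewrite [RHS]one.
  by move=> u v; split=> // /(tree_irr tT).
move=> [/card_enum[b [b_inj bP]] h2 h3].
have h2' k := card_enum (card_eq_trans (h2 k) (card_eqxx (of_card omega))).
have {h2 h2'} [c cP] : exists c : nat -> nat -> T, forall k, injective (c k) /\
    forall y, immediate_succ x y /\ node_type n (Some k) y <-> exists s, c k s = y.
  have /choice[c cP] := h2'; exists (fun k s => c k (omega_index s)) => k.
  have [c_inj ck] := cP k; split=> [s t /c_inj[]//|y].
  rewrite -[_ /\ _]/([set y | immediate_succ x y /\ node_type n (Some k) y] y) ck.
  split=> -[s <-]; last by exists (omega_index s).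
  by have [i ->] := omega_indexP s; exists i.
pose d (s : child_index N) := match s with inl a => b a | inr p => c p.1 p.2 end.
have dP s : immediate_succ x (d s) /\ node_type n (child_type s) (d s).
  case: s => [a|[k q]] /=; first by apply/bP; exists a.
  by apply/(cP k).2; exists q.
apply: (subtree_graft tT (b := d)) => [s t e|y|s]; last by apply: IH; exact: (dP s).2.
  have [_] := dP s; rewrite e => /node_type_inj/(_ (dP t).2).
  move: e; case: s => [a|[k q]]; case: t => [a'|[k' q']] //=.
    by move=> /b_inj ->.
  by move=> + [kk']; rewrite kk' => /(cP k').1 ->.
split=> [xy|[s <-]]; last exact: (dP s).1.
have [[k|] My] := h3 y xy.
  by have /(cP k).2[q <-] := conj xy My; exists (inr (k, q)).
have /bP[a <-] : [set y | immediate_succ x y /\ node_type n omega y] y by [].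
by exists (inl a).
Qed.

Lemma subtree_root (T : structure) (r : T) : is_root r -> isomorphic (subtree r) T.
Proof.
move=> rr; exists sval; split=> //.
have h y : y = r \/ prec r y by case: (rr y) => [->|]; [left|right].
by exists (fun y => exist _ y (h y)) => // -[y hy]; apply: eq_exist.
Qed.

Theorem node_type_model n N (T : structure) (r : T) : is_tree T -> is_root r ->
  node_type n N r -> isomorphic (tree_model n.+1 N) T.
Proof.
by move=> tT rr h; apply: isomorphic_trans (node_type_subtree tT h) (subtree_root rr).
Qed.

Theorem tree_type_model n N T : tree_type n.+1 N T -> isomorphic (tree_model n.+1 N) T.
Proof.
move=> tt; have tT := tree_type_is_tree tt; have [r rr] := tree_root tT.
exact: node_type_model tT rr (node_type_root rr tt).
Qed.

(** * Definability by infinitary formulas of finite level *)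

Definition query n := forall A : structure, ('I_n -> A) -> Prop.

Definition equivalent n (P Q : query n) := forall (A : structure) (v : 'I_n -> A), P A v <-> Q A v.

(** Pi ([univ] true) or Sigma ([univ] false) definability at level [l], with
properties of tuples in place of formulas.  Closure properties are easier to
prove here, since no normal form of formulas has to be maintained;
[definable_form] produces the formula in the end. *)
Fixpoint definable (univ : bool) (l n : nat) (P : query n) : Prop :=
  match l with
  | 0 => exists2 phi : form n, quantifier_free phi & equivalent P (fun A => @sat A n phi)
  | l'.+1 => exists (k : nat -> nat) (Q : forall i, query (k i + n)),
      (forall i, definable (~~ univ) l' (Q i)) /\
      equivalent P (if univ then fun A v => forall i w, Q i A (vcat w v)
              else fun A v => exists i w, Q i A (vcat w v))
  end.

Lemma definable_equivalent u l n (P Q : query n) :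
  equivalent P Q -> definable u l P -> definable u l Q.
Proof.
move=> PQ; have h R : equivalent P R -> equivalent Q R by move=> PR A v; rewrite -PQ.
case: l => [[phi qf e]|l [k [R [hR e]]]]; first by exists phi; last exact: h.
by exists k, R; split; last exact: h.
Qed.

Lemma definable_not u l n (P : query n) :
  definable u l P -> definable (~~ u) l (fun A v => ~ P A v).
Proof.
elim: l u n P => [|l IH] u n P.
  by case=> phi qf e; exists (FNot phi) => // A v /=; rewrite e.
case=> k [Q [hQ e]]; exists k, (fun i A v => ~ Q i A v); split.
  by move=> i; apply: IH; apply: hQ.
move=> A v; rewrite e; case: u {hQ e} => /=; split.
- by move=> /existsNP[i /existsNP[w h]]; exists i, w.
- by move=> [i [w h]] q; apply: h; apply: q.
- by move=> h i w q; apply: h; exists i, w.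
- by move=> h [i [w q]]; apply: h q.
Qed.

(** Meant for quantifier-free formulas, so that no binder has to be crossed. *)
Fixpoint rename_form n m (s : 'I_n -> 'I_m) (phi : form n) : form m :=
  match phi with
  | FPrec i j => FPrec (s i) (s j)
  | FEq i j => FEq (s i) (s j)
  | FNot p => FNot (rename_form s p)
  | FAnd p q => FAnd (rename_form s p) (rename_form s q)
  | FOr p q => FOr (rename_form s p) (rename_form s q)
  | _ => FFalse
  end.

Lemma rename_form_qf n m (s : 'I_n -> 'I_m) phi :
  quantifier_free phi -> quantifier_free (rename_form s phi).
Proof.
elim: phi m s => //= {n}n.
- by move=> p IHp q IHq m s [hp hq]; split; [apply: IHp|apply: IHq].
- by move=> p IHp q IHq m s [hp hq]; split; [apply: IHp|apply: IHq].
Qed.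

Lemma sat_rename_form n m (s : 'I_n -> 'I_m) phi (A : structure) (v : 'I_m -> A) :
  quantifier_free phi -> (sat (rename_form s phi) v <-> sat phi (v \o s)).
Proof.
elim: phi m s v => //= {n}n.
- by move=> p IHp m s v qf; rewrite IHp.
- by move=> p IHp q IHq m s v [hp hq]; rewrite IHp// IHq.
- by move=> p IHp q IHq m s v [hp hq]; rewrite IHp// IHq.
Qed.

Lemma definable_reindex u l n m (s : 'I_n -> 'I_m) (P : query n) :
  definable u l P -> definable u l (fun (A : structure) (v : 'I_m -> A) => P A (v \o s)).
Proof.
elim: l u n m s P => [|l IH] u n m s P.
  case=> phi qf e; exists (rename_form s phi); first exact: rename_form_qf.
  by move=> A v; rewrite sat_rename_form.
case=> k [Q [hQ e]]; exists k, (fun i A v => Q i A (v \o lift_index s)); split.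
  by move=> i; apply: IH; apply: hQ.
move=> A v; rewrite e; case: u {hQ e} => /=; split.
- by move=> h i w; rewrite vcat_lift_index.
- by move=> h i w; rewrite -vcat_lift_index.
- by move=> [i [w h]]; exists i, w; rewrite vcat_lift_index.
- by move=> [i [w h]]; exists i, w; rewrite -vcat_lift_index.
Qed.

Lemma definable_alt u l n (P : query n) : definable u l P -> definable (~~ u) l.+1 P.
Proof.
move=> dP; exists (fun=> 0), (fun _ => P); split; first by rewrite negbK.
move=> A v; case: u {dP} => /=; split.
- by move=> h; exists 0, (@vnil A); rewrite vcat0.
- by move=> [_ [w]]; rewrite vcat0.
- by move=> h _ w; rewrite vcat0.
- by move=> /(_ 0 (@vnil A)); rewrite vcat0.
Qed.

Lemma definableS u l n (P : query n) : definable u l P -> definable u l.+1 P.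
Proof.
elim: l u n P => [|l IH] u n P.
  by move=> h; have := @definable_alt (~~ u) 0 n P h; rewrite negbK.
case=> k [Q [hQ e]]; exists k, Q; split=> [i|//].
exact: IH (hQ i).
Qed.

Lemma definable_leq u l l' n (P : query n) : l <= l' -> definable u l P -> definable u l' P.
Proof. by move=> /subnK <-; elim: (l' - l) => // d IH /IH; apply: definableS. Qed.

Lemma definable_lt u u' l l' n (P : query n) : l < l' -> definable u l P -> definable u' l' P.
Proof.
move=> ll' h; apply: definable_leq ll' _.
case: (eqVneq u' u) => [->|]; first exact: definableS.
by case: u u' h => -[]// h _; apply: definable_alt h.
Qed.

(** Two disjunctions are merged by the coding of pairs of numbers, two blocks of
quantifiers by concatenation; [s] only reassociates the variables. *)
Lemma definable_bigex l n (k : nat -> nat) (Q : forall i, query (k i + n)) :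
  (forall i, definable false l.+1 (Q i)) ->
  definable false l.+1 (fun A v => exists i (w : 'I_(k i) -> A), Q i A (vcat w v)).
Proof.
move=> /choice[k' /(_ _)/cid hR]; pose R i := projT1 (hR i).
have dR i j : definable true l (R i j) := (projT2 (hR i)).1 j.
have eR i : equivalent (Q i) (fun A v => exists j w, R i j A (vcat w v)) := (projT2 (hR i)).2.
pose un c : nat * nat := odflt (0, 0) (unpickle c).
pose s p : 'I_(k' p.1 p.2 + (k p.1 + n)) -> 'I_(k' p.1 p.2 + k p.1 + n) :=
  vcat (lshift n \o @lshift _ (k p.1))
    (vcat (lshift n \o @rshift (k' p.1 p.2) _) (@rshift (k' p.1 p.2 + k p.1) n)).
exists (fun c => k' (un c).1 (un c).2 + k (un c).1).
exists (fun c A v => R (un c).1 (un c).2 A (v \o s (un c))); split.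
  by move=> c; apply: definable_reindex.
have sE c (A : structure) w w' (v : 'I_n -> A) :
    vcat (vcat w' w) v \o s c = vcat w' (vcat w v).
  rewrite /s !vcat_comp; congr vcat; last congr vcat; apply: funext => i /=;
  by rewrite ?vcat_lshift ?vcat_rshift ?vcat_lshift.
move=> A v /=; split.
  move=> [i [w /eR [j [w' h]]]]; have e : un (pickle (i, j)) = (i, j).
    by rewrite /un pickleK.
  by exists (pickle (i, j)); rewrite e; exists (vcat w' w); rewrite sE.
move=> [c [w h]]; exists (un c).1, (fun i => w (rshift _ i)); apply/eR.
exists (un c).2, (fun i => w (lshift _ i)); rewrite -sE.
by rewrite -(vcat_split w).
Qed.

Lemma definable_bigall l n (k : nat -> nat) (Q : forall i, query (k i + n)) :
  (forall i, definable true l.+1 (Q i)) ->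
  definable true l.+1 (fun A v => forall i (w : 'I_(k i) -> A), Q i A (vcat w v)).
Proof.
move=> h; have := definable_not (definable_bigex (fun i => definable_not (h i))).
apply: definable_equivalent => A v; split=> [H i w|H [i [w]]]; last by apply.
by apply: contrapT => q; apply: H; exists i, w.
Qed.

Lemma definable_ex l n k (Q : query (k + n)) : definable false l.+1 Q ->
  definable false l.+1 (fun A v => exists w : 'I_k -> A, Q A (vcat w v)).
Proof.
move=> h; have := @definable_bigex l n (fun=> k) (fun=> Q) (fun=> h).
by apply: definable_equivalent => A v; split=> [[]//|]; exists 0.
Qed.

Lemma definable_all l n k (Q : query (k + n)) : definable true l.+1 Q ->
  definable true l.+1 (fun A v => forall w : 'I_k -> A, Q A (vcat w v)).
Proof.
move=> h; have := @definable_bigall l n (fun=> k) (fun=> Q) (fun=> h).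
by apply: definable_equivalent => A v; split=> [/(_ 0)|].
Qed.

Lemma definable_conj l n (Q : nat -> query n) : (forall i, definable true l.+1 (Q i)) ->
  definable true l.+1 (fun A v => forall i, Q i A v).
Proof.
move=> h; have := @definable_bigall l n (fun=> 0) Q h.
apply: definable_equivalent => A v; split=> H i; last by move=> w; rewrite vcat0; exact: H.
by have := H i (@vnil A); rewrite vcat0.
Qed.

(** Pi is closed under countable conjunctions.  For Sigma, the disjunctions
distribute over the conjunction: [s] and [s'] select the variables of each
conjunct among those of both blocks. *)
Lemma definable_and u l n (P Q : query n) : definable u l P -> definable u l Q ->
  definable u l (fun A v => P A v /\ Q A v).
Proof.
elim: l u n P Q => [|l IH] u n P Q.
  case=> p qp ep [q qq eq]; exists (FAnd p q) => // A v /=; by rewrite ep eq.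
case: u => [dP dQ|].
  apply: definable_equivalent (@definable_conj l n (fun i => if i is 0 then P else Q) _).
    by move=> A v; split=> [h|[p q] []//]; split; [exact: (h 0)|exact: (h 1)].
  by move=> [|i]; [exact: dP|exact: dQ].
move=> [k [R [dR eR]]] [k' [R' [dR' eR']]].
pose un c : nat * nat := odflt (0, 0) (unpickle c).
pose s p : 'I_(k p.1 + n) -> 'I_(k p.1 + k' p.2 + n) :=
  vcat (lshift n \o @lshift _ (k' p.2)) (@rshift (k p.1 + k' p.2) n).
pose s' p : 'I_(k' p.2 + n) -> 'I_(k p.1 + k' p.2 + n) :=
  vcat (lshift n \o @rshift (k p.1) _) (@rshift (k p.1 + k' p.2) n).
exists (fun c => k (un c).1 + k' (un c).2).
exists (fun c A v => R (un c).1 A (v \o s (un c)) /\ R' (un c).2 A (v \o s' (un c))).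
split; first by move=> c; apply: IH; apply: definable_reindex; [exact: dR|exact: dR'].
have sE c (A : structure) w w' (v : 'I_n -> A) :
    vcat (vcat w w') v \o s c = vcat w v.
  rewrite /s !vcat_comp; congr vcat; apply: funext => i /=;
  by rewrite ?vcat_lshift ?vcat_rshift ?vcat_lshift.
have sE' c (A : structure) w w' (v : 'I_n -> A) :
    vcat (vcat w w') v \o s' c = vcat w' v.
  rewrite /s' !vcat_comp; congr vcat; apply: funext => i /=;
  by rewrite ?vcat_lshift ?vcat_rshift ?vcat_rshift.
move=> A v; rewrite eR eR' /=; split.
  move=> [[i [w h]] [j [w' h']]]; have e : un (pickle (i, j)) = (i, j).
    by rewrite /un pickleK.
  by exists (pickle (i, j)); rewrite e; exists (vcat w w'); rewrite sE sE'.
move=> [c [w [h h']]].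
split; [exists (un c).1, (fun i => w (lshift _ i))|
        exists (un c).2, (fun i => w (rshift _ i))].
  by rewrite -(sE (un c) _ _ (fun i => w (rshift _ i))) -(vcat_split w).
by rewrite -(sE' (un c) _ (fun i => w (lshift _ i))) -(vcat_split w).
Qed.

Lemma definable_or u l n (P Q : query n) : definable u l P -> definable u l Q ->
  definable u l (fun A v => P A v \/ Q A v).
Proof.
move=> /definable_not dP /definable_not dQ.
have := definable_not (definable_and dP dQ); rewrite negbK.
apply: definable_equivalent => A v; split=> [/not_andP[/contrapT|/contrapT]|]; [by left|by right|].
by case=> h [] // np nq.
Qed.

Lemma definable_imp u l n (P Q : query n) : definable (~~ u) l P -> definable u l Q ->
  definable u l (fun A v => P A v -> Q A v).
Proof.
move=> /definable_not; rewrite negbK => dP dQ; have := definable_or dP dQ.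
apply: definable_equivalent => A v; split=> [[]//|h].
by have [p|] := pselect (P A v); [right; apply: h|left].
Qed.

Lemma definable_true u l n : definable u l (fun (A : structure) (_ : 'I_n -> A) => True).
Proof.
apply: (@definable_leq u 0) => //; exists (FNot FFalse) => // A v /=; tauto.
Qed.

Lemma definable_fin u l n (T : finType) (Q : T -> query n) :
  (forall i, definable u l (Q i)) -> definable u l (fun A v => forall i, Q i A v).
Proof.
move=> dQ; suff h (s : seq T) : definable u l (fun A v => forall i, i \in s -> Q i A v).
  apply: definable_equivalent (h (enum T)) => A v; split=> H i; last by move=> _.
  by apply: H; rewrite mem_enum.
elim: s => [|j s IH]; first by apply: definable_equivalent (definable_true _ _ _).
apply: definable_equivalent (definable_and (dQ j) IH) => A v; split=> [[a b] i|h].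
  by rewrite inE => /orP[/eqP ->//|/b].
split=> [|i i_s]; first by apply: h; rewrite mem_head.
by apply: h; rewrite inE i_s orbT.
Qed.

Lemma definable_prec u l n (i j : 'I_n) : definable u l (fun A v => prec (v i) (v j)).
Proof. by apply: (@definable_leq u 0) => //; exists (FPrec i j). Qed.

Lemma definable_eq u l n (i j : 'I_n) : definable u l (fun A v => v i = v j).
Proof. by apply: (@definable_leq u 0) => //; exists (FEq i j). Qed.

Lemma definable_form u l n (P : query n) : definable u l P ->
  exists2 phi, (if u then Pi_in (ofin l) phi else Sigma_in (ofin l) phi) &
    equivalent P (fun A => @sat A n phi).
Proof.
elim: l u n P => [|l IH] u n P.
  case=> phi qf e; exists phi => //.
  by case: u; [apply: Pi_zero|apply: Sigma_zero] => //; apply: ole_refl.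
case=> k [Q [dQ eQ]]; have {dQ}/(_ _)/IH/cid2 h := dQ.
pose psi i := s2val (h i).
have hpsi i : if ~~ u then Pi_in (ofin l) (psi i) else Sigma_in (ofin l) (psi i).
  exact: (s2valP (h i)).
have epsi i : equivalent (Q i) (fun A => @sat A _ (psi i)) := s2valP' (h i).
have l0 : olt Ozero (ofin l.+1) by apply/ole_succ/ole_zero.
have ll : olt (ofin l) (ofin l.+1) by apply: ole_refl.
case: u h @psi hpsi epsi eQ => hQ psi /= hpsi epsi eQ.
  exists (FConj (fun i => all_block (psi i))).
    by apply: (@Pi_pos _ _ k (fun=> ofin l)).
  move=> A v; rewrite eQ /=; split=> [h i|h i w].
    by apply/sat_all_block => w; apply/epsi.
  by apply/epsi; move: w; apply/sat_all_block.
exists (FDisj (fun i => ex_block (psi i))).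
  by apply: (@Sigma_pos _ _ k (fun=> ofin l)).
move=> A v; rewrite eQ /=; split=> [[i [w h]]|[i /sat_ex_block[w h]]].
  by exists i; apply/sat_ex_block; exists w; apply/epsi.
by exists i, w; apply/epsi.
Qed.

(** * Conditions that characterize the trees of type omega *)

Section Conditions.
Variable T : structure.
Implicit Types x y z : T.

Fixpoint climbs (j : nat) x : Prop :=
  if j is j'.+1 then exists y, prec x y /\ climbs j' y else True.

(** The children counted are those of the largest type: for [n > 0] this is
[n : omega], expressed by the condition on all [k'].  For [n = 0] every element
above [x] counts; saying [prec] instead of [immediate_succ], which has a
quantifier of its own, keeps this case Sigma_1. *)
Fixpoint at_least (n k : nat) x : Prop :=
  match n with
  | 0 => exists y : 'I_k -> T, injective y /\ forall i, prec x (y i)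
  | n'.+1 => exists y : 'I_k -> T, injective y /\
      forall i, immediate_succ x (y i) /\ forall k', at_least n' k' (y i)
  end.

(** What all the [node_type n N] have in common.  A child of finite label [k] is
recognized by the number of its own children of the largest type, and having
infinitely many such children is split into having [p] of them for every [p]. *)
Fixpoint regular (n : nat) x : Prop :=
  match n with
  | 0 => forall y z, ~ (prec x y /\ prec y z)
  | n'.+1 => (forall y, immediate_succ x y -> regular n' y) /\
      forall k p, exists y : 'I_p -> T, injective y /\
        forall i, immediate_succ x (y i) /\ at_least n' k (y i) /\ ~ at_least n' k.+1 (y i)
  end.

Lemma card_le_of_card k N : `I_k #<= of_card N <-> if N is Some k' then k <= k' else True.
Proof. by case: N => [k'|] /=; [rewrite card_le_II|split=> // _; apply: card_leT]. Qed.

Lemma node_type_at_least n N x k : node_type n N x ->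
  (at_least n k x <-> if N is Some k' then k <= k' else True).
Proof.
rewrite -card_le_of_card; elim: n N x k => [|n IH] N x k.
  by move=> [/card_le_eqr <- _]; rewrite card_le_tuple.
move=> [/card_le_eqr <- h2 h3]; rewrite card_le_tuple /=.
have E y : immediate_succ x y -> (forall k', at_least n k' y) <-> node_type n omega y.
  move=> /h3[M My]; split=> [h|yo k']; last by apply/(IH _ _ _ yo); exact: card_leT.
  case: M My => // l My; have /(IH _ _ _ My) := h l.+1.
  by rewrite card_le_II ltnn.
by split=> -[y [y_inj yP]]; exists y; split=> // i; have [xy] := yP i => /(E _ xy).
Qed.

Lemma node_type_exactly n k M x : node_type n M x ->
  (at_least n k x /\ ~ at_least n k.+1 x <-> M = Some k).
Proof.
move=> h; rewrite !(node_type_at_least _ h); case: M h => [l|] _; last by split=> [[]|].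
split=> [[kl /negP]|[->]]; last by split=> //; rewrite ltnn.
by rewrite -leqNgt => lk; congr Some; apply/eqP; rewrite eqn_leq lk.
Qed.

Lemma node_type_regular n N x : node_type n N x -> regular n x.
Proof.
elim: n N x => [|n IH] N x /=; first by move=> [_ h] y z [xy]; exact: h.
move=> [h1 h2 h3]; split=> [y /h3[M]|k p]; first exact: IH.
have /card_le_tuple[y [y_inj yP]] :
    `I_p #<= [set y | immediate_succ x y /\ node_type n (Some k) y].
  by rewrite (card_le_eqr (h2 k)); exact: card_leT.
exists y; split=> // i; have [xy My] := yP i; split=> //.
exact/(node_type_exactly _ My).
Qed.

Lemma countable_card (P : set T) : countable P -> exists N, P #= of_card N.
Proof.
move=> cP; have [[k Pk]|] := pselect (finite_set P); first by exists (Some k).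
by exists omega; apply: eq_card_nat.
Qed.

(** In a countable structure, a set has a cardinality among the elements of
omega + 1, which provides [N]; and a set with arbitrarily long lists of distinct
elements is countably infinite. *)
Lemma regular_node_type n x : countable [set: T] -> regular n x ->
  exists N, node_type n N x.
Proof.
move=> cT; have cP (P : set T) : countable P by exact: sub_countable (card_leT P) cT.
elim: n x => [|n IH] x /=.
  move=> h; have [N hN] := countable_card (cP [set y | prec x y]).
  by exists N; split=> // y z xy yz; apply: h (conj xy yz).
move=> [h1 h2]; have h3 y xy := IH y (h1 y xy).
have [N hN] := countable_card (cP [set y | immediate_succ x y /\ node_type n omega y]).
exists N; split=> // k; apply: countable_infinite_nat => // p.
have [y [y_inj yP]] := h2 k p; exists y; split=> // i.
have [xy my] := yP i; split=> //; have [M My] := h3 _ xy.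
by have /(node_type_exactly _ My) <- := my.
Qed.

Lemma node_type_climbs n N x : is_tree T -> node_type n N x -> ~ climbs n.+2 x.
Proof.
move=> tT; elim: n N x => [|n IH] N x; first by move=> [_ h] [y [xy [z [yz _]]]]; exact: h xy yz.
move=> [_ _ h] [y [xy cy]]; have [z xz zy] := prec_child tT xy.
have [M /IH] := h z xz; apply; case: zy => [->//|zy].
by case: cy => w [yw cw]; exists w; split=> //; exact: (tree_trans tT) zy yw.
Qed.

(** Bounding the lengths of chains makes the finiteness of predecessors and the
absence of infinite paths expressible. *)
Record bounded_tree (h : nat) : Prop := BoundedTree {
  bounded_irr : forall x, ~ prec x x;
  bounded_trans : forall x y z, prec x y /\ prec y z -> prec x z;
  bounded_linear : forall x y z, prec y x /\ prec z x -> prec y z \/ y = z \/ prec z y;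
  bounded_root : exists r : T, is_root r;
  bounded_height : forall x, ~ climbs h x }.

Lemma bounded_tree_is_tree h : countable [set: T] -> bounded_tree h -> is_tree T.
Proof.
move=> cT [irr tr lin root hgt]; split=> //.
- by move=> x y z xy yz; apply: tr (conj xy yz).
- move=> x; apply: contrapT => x_inf.
  (* If only [y], but nothing below it, had infinitely many predecessors, then
     every predecessor of [y] would have a larger one and chains of any length
     would start there. *)
  have step y : infinite_set [set z | prec z y] ->
      exists2 z, prec z y & infinite_set [set w | prec w z].
    move=> y_inf; apply: contrapT => no.
    have fin z : prec z y -> finite_set [set w | prec w z].
      by move=> zy; apply: contrapT => z_inf; apply: no; exists z.
    have next z : prec z y -> exists2 w, prec z w & prec w y.
      move=> zy; apply: contrapT => nz; apply: y_inf.
      apply: (@sub_finite_set _ _ ([set z] `|` [set w | prec w z])).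
        move=> w wy; case: (lin y w z (conj wy zy)) => [|[->|zw]]; [by right|by left|].
        by case: nz; exists w.
      by rewrite finite_setU; split; [exact: finite_set1|exact: fin].
    have [z zy] := infinite_setN0 y_inf.
    suff climb j : forall w, prec w y -> climbs j w by exact: hgt (climb h z zy).
    elim: j => //= j IH w /next[w' ww' w'y]; exists w'; split=> //; exact: IH.
  (* Iterating [step] descends [h] times from [x]. *)
  suff [y [_ /hgt//]] : exists y, infinite_set [set z | prec z y] /\ climbs h y.
  elim: (h) => [|j [y [y_inf cy]]]; first by exists x.
  by have [z zy z_inf] := step y y_inf; exists z; split=> //; exists y.
- by move=> x y z xy yz; apply: lin (conj xy yz).
- move=> [f hf]; suff hc j : forall i, climbs j (f i) by exact: hgt (hc h 0).
  by elim: j => //= j IH i; exists (f i.+1).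
Qed.

Lemma tree_bounded_tree n N (r : T) : is_tree T -> is_root r -> node_type n N r ->
  bounded_tree n.+2.
Proof.
move=> tT rr tr; split.
- exact: tree_irr.
- by move=> x y z [xy yz]; exact: (tree_trans tT) xy yz.
- by move=> x y z [yx zx]; exact: (tree_linear tT) yx zx.
- by exists r.
- move=> x cx; apply: (node_type_climbs tT tr).
  case: (rr x) => [<-//|rx]; case: cx => y [xy cy].
  by exists y; split=> //; exact: (tree_trans tT) rx xy.
Qed.

(** The root is quantified universally: it exists and is unique by
[bounded_tree], and an existential quantifier in front of these conditions would
raise the complexity. *)
Definition omega_conditions m : Prop :=
  bounded_tree m.+2 /\ forall r : T, is_root r -> regular m r /\ forall k, at_least m k r.

Lemma omega_conditions_model m : countable [set: T] -> omega_conditions m ->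
  isomorphic (tree_model m.+1 omega) T.
Proof.
move=> cT [oT rT]; have tT := bounded_tree_is_tree cT oT.
have [r rr] := bounded_root oT; have [reg mr] := rT r rr.
have [N Nr] := regular_node_type cT reg.
have -> : omega = N.
  case: N Nr => // k kr; have /(node_type_at_least _ kr) := mr k.+1.
  by rewrite ltnn.
exact: node_type_model tT rr Nr.
Qed.

Lemma tree_type_omega_conditions m : tree_type m.+1 omega T -> omega_conditions m.
Proof.
move=> tt; have tT := tree_type_is_tree tt.
have hr (r : T) : is_root r -> node_type m omega r by move=> rr; exact: node_type_root rr tt.
have [r rr] := tree_root tT; split; first exact: tree_bounded_tree tT rr (hr r rr).
move=> s /hr sO; split; first exact: node_type_regular sO.
by move=> k; apply/(node_type_at_least _ sO).
Qed.

End Conditions.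

(** * Complexity of the conditions *)

Lemma definable_const u l n (P : Prop) : definable u l (fun (A : structure) (_ : 'I_n -> A) => P).
Proof.
have [p|np] := pselect P; first by apply: definable_equivalent (definable_true u l n) => A v.
have := definable_not (definable_true (~~ u) l n); rewrite negbK.
by apply: definable_equivalent => A v; split.
Qed.

Lemma definable_injective u l n k (s : 'I_k -> 'I_n) :
  definable u l (fun (A : structure) (v : 'I_n -> A) => injective (v \o s)).
Proof.
apply: (@definable_equivalent _ _ _ (fun A v => forall i j, v (s i) = v (s j) -> i = j)) => [//|].
apply: definable_fin => i; apply: definable_fin => j; apply: definable_imp.
  exact: definable_eq.
exact: definable_const.
Qed.

Lemma definable_succ n (i j : 'I_n) :
  definable true 1 (fun A v => immediate_succ (v i) (v j)).
Proof.
apply: definable_and; first exact: definable_prec.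
have := @definable_all 0 n 1 (fun A u => ~ (prec (u (rshift 1 i)) (u (lshift n ord0)) /\
   prec (u (lshift n ord0)) (u (rshift 1 j)))).
move=> h; apply: definable_equivalent (h _) => [A v|].
  split=> [H [z zP]|H w]; last by rewrite !vcat_rshift vcat_lshift => wP; apply: H; exists (w ord0).
  by have := H (fun=> z); rewrite !vcat_rshift vcat_lshift; apply.
apply: (@definable_not false); apply: definable_and; exact: definable_prec.
Qed.

Lemma definable_climbs j n (i : 'I_n) : definable false 1 (fun A v => climbs j (v i)).
Proof.
elim: j n i => [|j IH] n i; first exact: definable_true.
have := @definable_ex 0 n 1 (fun A u => prec (u (rshift 1 i)) (u (lshift n ord0)) /\
   climbs j (u (lshift n ord0))).
move=> h; apply: definable_equivalent (h _) => [A v|].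
  split=> [[w]|[z zP]].
    by rewrite vcat_rshift vcat_lshift => wP; exists (w ord0).
  by exists (fun=> z); rewrite vcat_rshift vcat_lshift.
by apply: definable_and; [exact: definable_prec|exact: IH].
Qed.

Lemma definable_ex_injective l n p (i : 'I_n)
    (R : forall A : structure, A -> A -> Prop) :
  (forall m (i j : 'I_m), definable false l.+1 (fun A v => R A (v i) (v j))) ->
  definable false l.+1 (fun A v => exists y : 'I_p -> A,
    injective y /\ forall j, R A (v i) (y j)).
Proof.
move=> dR; have := @definable_ex l n p (fun A u => injective (u \o @lshift p n) /\
  forall j, R A (u (rshift p i)) (u (lshift n j))).
move=> h; apply: definable_equivalent (h _) => [A v|].
  have E w : vcat w v \o @lshift p n = w.
    by apply: funext => j /=; rewrite vcat_lshift.
  split=> -[w [w_inj wP]]; exists w; move: w_inj; rewrite E => w_inj; split=> // j.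
    by have := wP j; rewrite vcat_rshift vcat_lshift.
  by rewrite vcat_rshift vcat_lshift.
by apply: definable_and; [exact: definable_injective|exact: definable_fin].
Qed.

(** Going from [n] to [n.+1], the conjunction over [k'] gives Pi_(2n+2) and the
choice of the children Sigma_(2n+3). *)
Lemma definable_at_least n k m (i : 'I_m) :
  definable false (2 * n).+1 (fun A v => at_least n k (v i)).
Proof.
elim: n k m i => [|n IH] k m i.
  apply: (@definable_ex_injective 0) => m' i' j'; exact: definable_prec.
rewrite mulnS; apply: (@definable_ex_injective _ _ _ _ (fun A x y =>
  immediate_succ x y /\ forall k', at_least n k' y)) => m' i' j'.
apply: definable_and; first by apply: definable_lt (definable_succ i' j').
apply: (@definable_lt true _ (2 * n).+2) => //; apply: definable_conj => k'.
by apply: definable_lt (IH k' _ j').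
Qed.

(** The number of children of the largest type is exactly [k] by a conjunction
of a Sigma_(2n+1) and a Pi_(2n+1) condition, hence Sigma_(2n+2) once [p]
children are chosen, and Pi_(2n+3) after the conjunction over [k] and [p]. *)
Lemma definable_regular n m (i : 'I_m) :
  definable true (2 * n).+1 (fun A v => regular n (v i)).
Proof.
elim: n m i => [|n IH] m i.
  have := @definable_all 0 m 2 (fun A u => ~ (prec (u (rshift 2 i)) (u (lshift m ord0)) /\
    prec (u (lshift m ord0)) (u (lshift m ord_max)))).
  move=> h; apply: definable_equivalent (h _) => [A v|].
    split=> [H y z|H w]; last by rewrite vcat_rshift !vcat_lshift; apply: H.
    by have := H (fun i => if val i is 0 then y else z); rewrite vcat_rshift !vcat_lshift.
  apply: (@definable_not false); apply: definable_and; exact: definable_prec.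
rewrite mulnS; apply: definable_and.
  have := @definable_all (2 + 2 * n) m 1 (fun A u =>
    immediate_succ (u (rshift 1 i)) (u (lshift m ord0)) -> regular n (u (lshift m ord0))).
  move=> h; apply: definable_equivalent (h _) => [A v|].
    split=> [H y|H w]; last by rewrite vcat_rshift vcat_lshift; apply: H.
    by have := H (fun=> y); rewrite vcat_rshift vcat_lshift.
  apply: definable_imp; first by apply: definable_lt (definable_succ _ _).
  by apply: definable_leq (IH _ _); rewrite ltnS leq_addl.
apply: definable_conj => k; apply: definable_conj => p.
apply: (@definable_lt false _ (2 * n).+2) => //.
apply: (@definable_ex_injective _ _ _ _ (fun A x y =>
  immediate_succ x y /\ at_least n k y /\ ~ at_least n k.+1 y)) => m' i' j'.
apply: definable_and; first by apply: definable_lt (definable_succ i' j').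
apply: definable_and; first by apply: definable_leq (definable_at_least _ _ _).
by apply: definable_lt (definable_not (definable_at_least _ _ _)).
Qed.

Lemma definable_root n (i : 'I_n) : definable true 1 (fun A v => is_root (v i)).
Proof.
have := @definable_all 0 n 1 (fun A u => u (lshift n ord0) = u (rshift 1 i) \/
   prec (u (rshift 1 i)) (u (lshift n ord0))).
move=> h; apply: definable_equivalent (h _) => [A v|].
  split=> [H y|H w]; last by rewrite vcat_rshift vcat_lshift; apply: H.
  by have := H (fun=> y); rewrite vcat_rshift vcat_lshift.
by apply: definable_or; [exact: definable_eq|exact: definable_prec].
Qed.

Lemma definable_forall k l (Q : query k) : definable true l.+1 Q ->
  definable true l.+1 (fun A (_ : 'I_0 -> A) => forall w : 'I_k -> A, Q A w).
Proof.
move=> dQ; have := definable_all (definable_reindex (@lshift k 0) dQ).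
have E (A : structure) (w : 'I_k -> A) v : vcat w v \o @lshift k 0 = w.
  by apply: funext => i /=; rewrite vcat_lshift.
by apply: definable_equivalent => A v; split=> H w; have := H w; rewrite E.
Qed.

(** The existence of a root is Sigma_2, hence the level 3; the other conditions
are Pi_1. *)
Lemma definable_bounded_tree h l : 2 <= l ->
  definable true l.+1 (fun A (_ : 'I_0 -> A) => bounded_tree A h).
Proof.
move=> l2.
pose o3 : 'I_3 := Ordinal (isT : 2 < 3); pose o2 : 'I_3 := Ordinal (isT : 1 < 3).
have d1 : definable true l.+1 (fun A (_ : 'I_0 -> A) => forall w : 'I_1 -> A,
    ~ prec (w ord0) (w ord0)).
  by apply: definable_forall; apply: (@definable_not false); exact: definable_prec.
have d2 : definable true l.+1 (fun A (_ : 'I_0 -> A) => forall w : 'I_3 -> A,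
    prec (w ord0) (w o2) /\ prec (w o2) (w o3) -> prec (w ord0) (w o3)).
  apply: definable_forall; apply: definable_imp; last exact: definable_prec.
  by apply: definable_and; exact: definable_prec.
have d3 : definable true l.+1 (fun A (_ : 'I_0 -> A) => forall w : 'I_3 -> A,
    prec (w o2) (w ord0) /\ prec (w o3) (w ord0) ->
    prec (w o2) (w o3) \/ w o2 = w o3 \/ prec (w o3) (w o2)).
  apply: definable_forall; apply: definable_imp.
    by apply: definable_and; exact: definable_prec.
  apply: definable_or; first exact: definable_prec.
  by apply: definable_or; [exact: definable_eq|exact: definable_prec].
have d4 : definable true l.+1 (fun A (_ : 'I_0 -> A) => exists r : A, is_root r).
  apply: (@definable_lt false _ 2) => //.
  have := @definable_not true 2 0 _ (definable_forall (definable_not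
    (@definable_lt true false 1 2 _ _ isT (definable_root (ord0 : 'I_1))))).
  apply: definable_equivalent => A v; split=> [/existsNP[w /contrapT hw]|[r rr] H].
    by exists (w ord0).
  exact: (H (fun=> r)).
have d5 : definable true l.+1 (fun A (_ : 'I_0 -> A) => forall w : 'I_1 -> A, ~ climbs h (w ord0)).
  apply: definable_forall; apply: (definable_leq (l := 1)) => //.
  exact: definable_not (definable_climbs _ _).
have := definable_and d1 (definable_and d2 (definable_and d3 (definable_and d4 d5))).
apply: definable_equivalent => A v; split=> [[h1 [h2 [h3 [h4 h5]]]]|[h1 h2 h3 h4 h5]].
  have tri x y z : exists w : 'I_3 -> A, [/\ w ord0 = x, w o2 = y & w o3 = z].
    by exists (fun i => match val i with 0 => x | 1 => y | _ => z end).
  split=> [x|x y z|x y z||x] //.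
  - exact: (h1 (fun=> x)).
  - by have [w [<- <- <-]] := tri x y z; exact: h2.
  - by have [w [<- <- <-]] := tri x y z; exact: h3.
  - exact: (h5 (fun=> x)).
split=> [w|]; first exact: h1.
split=> [w|]; first exact: h2.
split=> [w|]; first exact: h3.
by split=> // w; exact: h5.
Qed.

Lemma definable_omega_conditions m : 0 < m ->
  definable true (2 * m + 2) (fun A (_ : 'I_0 -> A) => omega_conditions A m).
Proof.
move=> m0; rewrite addn2; apply: definable_and.
  by apply: definable_bounded_tree; case: m m0 => // m _; rewrite mulnS.
have := @definable_forall 1 (2 * m).+1 (fun A w =>
  is_root (w ord0) -> regular m (w ord0) /\ forall k, at_least m k (w ord0)).
move=> h; apply: definable_equivalent (h _) => [A v|].
  by split=> H r; [exact: (H (fun=> r))|exact: H].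
apply: definable_imp; first by apply: definable_lt (definable_root _).
apply: definable_and; first by apply: definable_leq (definable_regular _ _).
by apply: definable_conj => k; apply: definable_lt (definable_at_least _ _ _).
Qed.

Lemma omega_scott_sentence m A : 0 < m -> tree_type m.+1 omega A ->
  has_scott_sentence A (CPi (ofin (2 * m + 2))).
Proof.
move=> m0 tA; have [phi phi_P phiE] := definable_form (definable_omega_conditions m0).
exists phi => // B _ cB; rewrite /models -phiE; split=> [/(omega_conditions_model cB)|AB].
  by apply: isomorphic_trans; apply: isomorphic_sym; exact: tree_type_model.
by apply: tree_type_omega_conditions; exact: tree_type_iso AB tA.
Qed.

Theorem theorem1p4 (m : nat) (hm : 1 <= m) (A : structure)
  (hA : tree_type m.+1 omega A) : SSC A (CPi (ofin (2 * m + 2))).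
Proof.
split; first exact: omega_scott_sentence.
move=> d [phi phi_d phi_A]; apply: SSC_lower_bound; exists phi => // B hB cB.
rewrite (phi_A B hB cB); have iA := tree_type_model hA.
split; last by apply: isomorphic_trans; apply: isomorphic_sym.
exact: isomorphic_trans iA.
Qed.
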